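(* Let $X$ be a set, $\Omega$ a nonempty set disjoint from $X$, and $\lambda_\Omega=(\lambda_\omega)_{\omega\in\Omega}$ a family of elements of $\mathbf{k}$. The sextuple $(\mathrm{Sha}^{NC}_{RT}(X,\Omega),\,\diamond_\ell,\,u_\ell,\,\Delta_\ell,\,\epsilon_\ell,\,(B_\omega^+)_{\omega\in\Omega})$ is an $\Omega$-cocycle Hopf algebra.
   Context: $\mathbf{k}$ is a fixed unitary commutative ring; everything is over $\mathbf{k}$. An $\Omega$-cocycle bialgebra is a bialgebra $(H,m,1_H,\Delta,\varepsilon)$ with a family of linear operators $P_\omega:H\to H$, $\omega\in\Omega$, satisfying $\Delta P_\omega=P_\omega\otimes1_H+(\mathrm{id}\otimes P_\omega)\Delta$ for all $\omega\in\Omega$. It is an $\Omega$-cocycle Hopf algebra if the bialgebra is a Hopf algebra. Forests: $\mathcal{F}(X,\Omega)$ is the set of planar rooted forests (noncommutative concatenations of planar rooted trees, with $1$ the empty forest) with vertices decorated by $X\sqcup\Omega$ such that internal (non-leaf) vertices are decorated by $\Omega$ only (leaves may be decorated by $X$ or $\Omega$; the vertex of a one-vertex tree counts as a leaf). $\mathbf{k}\mathcal{F}(X,\Omega)$ has the concatenation product and the grafting operators $B_\omega^+$ (graft a forest on a new root decorated by $\omega$, $B_\omega^+(1)=\bullet_\omega$). A subforest $G$ of a forest $F$ consists of a set of vertices of $F$ with all their descendants and connecting edges (including $1$ and $F$); $F/G$ is $F$ with $G$ and the edges connecting $G$ to the rest removed; $\Delta_{RT}(F):=\sum_GG\otimes(F/G)$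 over all subforests $G$. Bracketed words: for a set $Y$ and $\omega\in\Omega$, $\lfloor Y\rfloor_\omega=\{\lfloor y\rfloor_\omega\mid y\in Y\}$ is a copy of $Y$, disjoint from $Y$ and from the copies for other $\omega$. With $M(\cdot)$ (resp. $S(\cdot)$) the free monoid (resp. free semigroup), $\mathfrak{M}_0:=M(X)$, $\mathfrak{M}_{n+1}:=M\big(X\sqcup\bigsqcup_\omega\lfloor\mathfrak{M}_n\rfloor_\omega\big)$, $\mathfrak{M}(X,\Omega):=\bigcup_n\mathfrak{M}_n$; $\mathbf{k}\mathfrak{M}(X,\Omega)$ has concatenation product and operators $P_\omega(u)=\lfloor u\rfloor_\omega$. $\theta:\mathbf{k}\mathfrak{M}(X,\Omega)\to\mathbf{k}\mathcal{F}(X,\Omega)$ is the algebra isomorphism with $\theta(x)=\bullet_x$, $\theta(\lfloor w\rfloor_\omega)=B_\omega^+(\theta(w))$. With $U^r$ the $r$-fold product set ($U^0=\{1\}$) and $\lfloor U\rfloor_\Omega=\{\lfloor u\rfloor_\omega\mid u\in U,\omega\in\Omega\}$, let $$\Lambda(Y,Z):=\Big(\bigcup_{r\ge1}(Y\lfloor Z\rfloor_\Omega)^r\Big)\cup\Big(\bigcup_{r\ge0}(Y\lfloor Z\rfloor_\Omega)^rY\Big)\cup\Big(\bigcup_{r\ge1}(\lfloor Z\rfloor_\Omega Y)^r\Big)\cup\Big(\bigcup_{r\ge0}(\lfloor Z\rfloor_\Omega Y)^r\lfloor Z\rfloor_\Omega\Big)\cup\{1\},$$ $\mathfrak{X}_0:=M(X)$,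 $\mathfrak{X}_n:=\Lambda(S(X),\mathfrak{X}_{n-1})$, $\mathfrak{X}_\infty:=\bigcup_n\mathfrak{X}_n$ (the bracketed words with no subword $\lfloor u\rfloor_\alpha\lfloor v\rfloor_\beta$). Let $\mathrm{Id}(S)$ be the operated ideal of $\mathbf{k}\mathfrak{M}(X,\Omega)$ (smallest ideal closed under all $P_\omega$) generated by $S=\{\lfloor x\rfloor_\alpha\lfloor y\rfloor_\beta-\lfloor x\lfloor y\rfloor_\beta\rfloor_\alpha-\lfloor\lfloor x\rfloor_\alpha y\rfloor_\beta-\lambda_\beta\lfloor xy\rfloor_\alpha\mid x,y\in\mathfrak{M}(X,\Omega),\alpha,\beta\in\Omega\}$. One has $\mathbf{k}\mathfrak{M}(X,\Omega)=\mathrm{Id}(S)\oplus\mathbf{k}\mathfrak{X}_\infty$; $\varphi$ is the projection onto $\mathbf{k}\mathfrak{X}_\infty$, and $\mathbf{k}\mathfrak{X}_\infty$ carries the product of the quotient by $\mathrm{Id}(S)$, $w\diamond_{\mathfrak{w}}w'=\varphi(ww')$. Transport to forests: $\mathfrak{L}_\infty:=\theta(\mathfrak{X}_\infty)$, $\mathrm{Sha}^{NC}_{RT}(X,\Omega):=\mathbf{k}\mathfrak{L}_\infty$, with product $F\diamond_\ell F':=\theta(\theta^{-1}(F)\diamond_{\mathfrak{w}}\theta^{-1}(F'))$ and operators $B_\omega^+$; it is the free matching Rota-Baxter algebra of weight $\lambda_\Omega$ on $X$ (i.e. free among algebras with operators satisfying $P_\alpha(x)P_\beta(y)=P_\alpha(xP_\beta(y))+P_\beta(P_\alpha(x)y)+\lambda_\beta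 P_\alpha(xy)$). $i:\mathrm{Sha}^{NC}_{RT}(X,\Omega)\to\mathbf{k}\mathcal{F}(X,\Omega)$ is the inclusion and $\psi:=\theta\varphi\theta^{-1}:\mathbf{k}\mathcal{F}(X,\Omega)\to\mathrm{Sha}^{NC}_{RT}(X,\Omega)$. The unit map is $u_\ell:\mathbf{k}\to\mathrm{Sha}^{NC}_{RT}(X,\Omega)$, $1_{\mathbf{k}}\mapsto1$; the coproduct is $\Delta_\ell:=(\psi\otimes\psi)\Delta_{RT}\,i$; and $\epsilon_\ell:\mathrm{Sha}^{NC}_{RT}(X,\Omega)\to\mathbf{k}$ is linear with $\epsilon_\ell(1)=1$ and $\epsilon_\ell(F)=0$ for $1\ne F\in\mathfrak{L}_\infty$. *)

(* Defs.v *)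
From HB Require Import structures.
From mathcomp Require Import all_boot all_order all_algebra finmap.
From mathcomp Require Import boolp classical_sets.
From mathcomp Require Import monalg.

Set Implicit Arguments.
Unset Strict Implicit.
Unset Printing Implicit Defensive.

Import GRing.Theory.
Local Open Scope ring_scope.

(* The free module on B.  It is {malg k[B]}, renamed because the library gives
   the latter a module structure only over nontrivial rings, whereas here k may
   be the zero ring. *)
Definition freeMod (k : comPzRingType) (B : choiceType) := {malg k[B]}.

Section FreeModule.
Variables (k : comPzRingType) (B : choiceType).
Implicit Types (c d : k) (a b : freeMod k B).

HB.instance Definition _ := GRing.Zmodule.on (freeMod k B).

Definition fmscale c a : freeMod k B := [malg x in msupp a => c * a@_x].

Lemma fmscaleE c a x : (fmscale c a)@_x = c * a@_x.
Proof.
by rewrite mcoeffE; case: msuppP; rewrite ?mulr0.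
Qed.

Fact fmscaleA c d a : fmscale c (fmscale d a) = fmscale (c * d) a.
Proof. by apply/malgP => x; rewrite !fmscaleE mulrA. Qed.

Fact fmscale1 : left_id 1 fmscale.
Proof. by move=> a; apply/malgP => x; rewrite fmscaleE mul1r. Qed.

Fact fmscaleDr : right_distributive fmscale +%R.
Proof. by move=> c a b; apply/malgP => x; rewrite !(mcoeffD, fmscaleE) mulrDr. Qed.

Fact fmscaleDl a : {morph fmscale^~ a : c d / c + d}.
Proof. by move=> c d; apply/malgP => x; rewrite !(mcoeffD, fmscaleE) mulrDl. Qed.

HB.instance Definition _ := GRing.Zmodule_isLmodule.Build k (freeMod k B)
  fmscaleA fmscale1 fmscaleDr fmscaleDl.

Definition basis (x : B) : freeMod k B := << 1 *g x >>.

Definition linext (M : lmodType k) (f : B -> M) (a : freeMod k B) : M :=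
  \sum_(x <- msupp a) a@_x *: f x.

End FreeModule.

(* The tensor product of the free modules on A and B is the free module on
   A * B, the pair (x, y) standing for x (x) y. *)
Section Tensor.
Variable k : comPzRingType.

Definition tens (A B : choiceType) (a : freeMod k A) (b : freeMod k B)
    : freeMod k (A * B)%type :=
  linext (fun x => linext (fun y => basis k (x, y)) b) a.

Definition tensmap (A B C D : choiceType)
    (f : freeMod k A -> freeMod k C) (g : freeMod k B -> freeMod k D)
    : freeMod k (A * B)%type -> freeMod k (C * D)%type :=
  linext (fun p => tens (f (basis k p.1)) (g (basis k p.2))).

Definition tensA (A B C : choiceType)
    : freeMod k ((A * B) * C)%type -> freeMod k (A * (B * C))%type :=
  linext (fun p => basis k (p.1.1, (p.1.2, p.2))).

End Tensor.

Section CocycleHopf.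
Variables (k : comPzRingType) (B : choiceType) (Omega : Type).
Notation H := (freeMod k B).
Notation HH := (freeMod k (B * B)%type).
Variables (mul : H -> H -> H) (u : k -> H).
Variables (Delta : H -> HH) (eps : H -> k).
Variable P : Omega -> H -> H.

Record is_algebra : Prop := IsAlgebra {
  algebra_linl : forall b, linear (mul^~ b);
  algebra_linr : forall a, linear (mul a);
  algebra_mulA : associative mul;
  algebra_unit_lin : linear (u : k^o -> H);
  algebra_mul1l : left_id (u 1) mul;
  algebra_mul1r : right_id (u 1) mul }.

Record is_coalgebra : Prop := IsCoalgebra {
  coalgebra_lin : linear Delta;
  coalgebra_eps_lin : scalar eps;
  coalgebra_coassoc : forall a,
    tensA (tensmap Delta id (Delta a)) = tensmap id Delta (Delta a);
  coalgebra_counitl : forall a,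
    linext (fun p => eps (basis k p.1) *: basis k p.2) (Delta a) = a;
  coalgebra_counitr : forall a,
    linext (fun p => eps (basis k p.2) *: basis k p.1) (Delta a) = a }.

Definition tensmul (s t : HH) : HH :=
  linext (fun p => linext (fun q =>
    tens (mul (basis k p.1) (basis k q.1)) (mul (basis k p.2) (basis k q.2))) t) s.

Record is_bialgebra : Prop := IsBialgebra {
  bialgebra_algebra : is_algebra;
  bialgebra_coalgebra : is_coalgebra;
  bialgebra_Delta1 : Delta (u 1) = tens (u 1) (u 1);
  bialgebra_DeltaM : forall a b, Delta (mul a b) = tensmul (Delta a) (Delta b);
  bialgebra_eps1 : eps (u 1) = 1;
  bialgebra_epsM : forall a b, eps (mul a b) = eps a * eps b }.

Definition multens : HH -> H :=
  linext (fun p => mul (basis k p.1) (basis k p.2)).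

Definition is_antipode (S : H -> H) : Prop :=
  [/\ linear S,
      forall a, multens (tensmap S id (Delta a)) = u (eps a) &
      forall a, multens (tensmap id S (Delta a)) = u (eps a)].

Definition is_hopf_algebra : Prop :=
  is_bialgebra /\ exists S, is_antipode S.

Definition is_cocycle_family : Prop :=
  forall w, linear (P w) /\
    forall a, Delta (P w a) = tens (P w a) (u 1) + tensmap id (P w) (Delta a).

Definition is_cocycle_bialgebra : Prop := is_bialgebra /\ is_cocycle_family.

Definition is_cocycle_hopf_algebra : Prop :=
  is_cocycle_bialgebra /\ is_hopf_algebra.

End CocycleHopf.

(* [iflat g n [:: x0; x1; ...]] is [g n x0 ++ g n.+1 x1 ++ ...]. *)
Definition iflat (A B : Type) (g : nat -> A -> seq B) : nat -> seq A -> seq B :=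
  fix go n s := if s is x :: s' then g n x ++ go n.+1 s' else [::].

(* Planar rooted trees.  A vertex decorated by X has no children; a vertex
   decorated by Omega is a leaf when its list of children is empty. *)
Inductive tree (X Omega : Type) : Type :=
| Leaf of X
| Node of Omega & seq (tree X Omega).
Arguments Leaf {X Omega}.
Arguments Node {X Omega}.

HB.instance Definition _ (X Omega : Type) := gen_eqMixin (tree X Omega).
HB.instance Definition _ (X Omega : Type) := gen_choiceMixin (tree X Omega).

(* The empty forest 1 is [::]. *)
Definition forest (X Omega : Type) := seq (tree X Omega).

(* A vertex of a forest is addressed by the position of its tree followed by
   the successive child positions leading to it; the root of a tree has the
   empty address in that tree.  The descendants of a are the vertices of which
   a is a prefix. *)
Definition address := seq nat.

Section Coproduct.
Variables X Omega : Type.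
Notation tree := (tree X Omega).
Notation forest := (forest X Omega).

Fixpoint tree_vertices (t : tree) : seq address :=
  [::] :: match t with
          | Leaf _ => [::]
          | Node _ f => iflat (fun i s => map (cons i) (tree_vertices s)) 0 f
          end.

Definition vertices (F : forest) : {fset address} :=
  [fset a in iflat (fun i s => map (cons i) (tree_vertices s)) 0 F]%fset.

Definition subforests (F : forest) : {fset {fset address}} :=
  [fset G in fpowerset (vertices F) |
    `[< forall a b, a \in G -> b \in vertices F -> prefix a b -> b \in G >]]%fset.

(* [restrict F D] keeps the vertices of F in D and the edges between them. *)
Fixpoint restrict_tree (t : tree) (D : pred address) : forest :=
  match t with
  | Leaf x => if D [::] then [:: Leaf x] else [::]
  | Node w f =>
      let c := iflat (fun i s => restrict_tree s (fun a => D (i :: a))) 0 f in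
      if D [::] then [:: Node w c] else c
  end.

Definition restrict (F : forest) (D : pred address) : forest :=
  iflat (fun i s => restrict_tree s (fun a => D (i :: a))) 0 F.

Variable k : comPzRingType.

(* G ranges over sets of vertices, so isomorphic subforests count separately. *)
Definition Delta_RT : freeMod k forest -> freeMod k (forest * forest)%type :=
  linext (fun F => \sum_(G <- subforests F)
    basis k (restrict F [pred a | a \in G], restrict F [pred a | a \notin G])).

End Coproduct.

(* Bracketed words: the inductive type below is the union of the M_n. *)
Inductive letter (X Omega : Type) : Type :=
| Var of X
| Bracket of Omega & seq (letter X Omega).
Arguments Var {X Omega}.
Arguments Bracket {X Omega}.

HB.instance Definition _ (X Omega : Type) := gen_eqMixin (letter X Omega).
HB.instance Definition _ (X Omega : Type) := gen_choiceMixin (letter X Omega).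

Definition word (X Omega : Type) := seq (letter X Omega).

Section RotaBaxterWords.
Variables X Omega : Type.
Notation word := (word X Omega).
Local Open Scope classical_set_scope.

Definition prodset (U V : set word) : set word :=
  [set u ++ v | u in U & v in V].

Definition powset (U : set word) (r : nat) : set word :=
  iter r (prodset U) [set [::]].

Definition brackets (U : set word) : set word :=
  [set [:: Bracket w u] | w in [set: Omega] & u in U].

Definition free_monoid : set word := [set map Var s | s in [set: seq X]].
Definition free_semigroup : set word :=
  [set map Var s | s in [set s : seq X | s <> [::]]].

Definition Lambda (Y Z : set word) : set word :=
  (\bigcup_(r in [set r | (1 <= r)%N]) powset (prodset Y (brackets Z)) r)
  `|` (\bigcup_r prodset (powset (prodset Y (brackets Z)) r) Y)
  `|` (\bigcup_(r in [set r | (1 <= r)%N]) powset (prodset (brackets Z) Y) r)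
  `|` (\bigcup_r prodset (powset (prodset (brackets Z) Y) r) (brackets Z))
  `|` [set [::]].

Fixpoint Xn (n : nat) : set word :=
  if n is n'.+1 then Lambda free_semigroup (Xn n') else free_monoid.

Definition Xinf : set word := \bigcup_n Xn n.

Lemma Xinf_nil : Xinf [::].
Proof. by exists 0%N => //; exists [::]. Qed.

Lemma Xinf_bracket w u : Xinf u -> Xinf [:: Bracket w u].
Proof.
move=> [n _ Xu]; exists n.+1 => //; left; right; exists 0%N => //.
by exists [::] => //; exists [:: Bracket w u] => //; exists w => //; exists u.
Qed.

End RotaBaxterWords.

Section OperatedIdeal.
Variables (k : comPzRingType) (X Omega : Type) (lam : Omega -> k).
Notation kM := (freeMod k (word X Omega)).
Local Open Scope classical_set_scope.

Definition concat (a b : kM) : kM :=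
  linext (fun u => linext (fun v => basis k (u ++ v)) b) a.

Definition bracket (w : Omega) : kM -> kM :=
  linext (fun u => basis k [:: Bracket w u]).

Record is_operated_ideal (I : set kM) : Prop := IsOperatedIdeal {
  operated_ideal0 : I 0;
  operated_idealD : forall a b, I a -> I b -> I (a + b);
  operated_idealZ : forall (c : k) a, I a -> I (c *: a);
  operated_idealMl : forall a b, I b -> I (concat a b);
  operated_idealMr : forall a b, I a -> I (concat a b);
  operated_idealP : forall w a, I a -> I (bracket w a) }.

Definition Id (S : set kM) : set kM :=
  [set a | forall I, is_operated_ideal I -> S `<=` I -> I a].

Definition RB_relations : set kM :=
  [set r | exists (x y : word X Omega) (al be : Omega),
    r = basis k [:: Bracket al x; Bracket be y]
      - basis k [:: Bracket al (x ++ [:: Bracket be y])]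
      - basis k [:: Bracket be (Bracket al x :: y)]
      - lam be *: basis k [:: Bracket al (x ++ y)]].

Notation kXinf := (freeMod k (set_type (@Xinf X Omega))).

Definition Xincl : kXinf -> kM := linext (fun w => basis k (val w)).

(* The projection onto k Xinf along Id(S): the image of a is the element of
   k Xinf congruent to a modulo Id(S), which exists and is unique since k Xinf
   is a complement of Id(S). *)
Definition phi (a : kM) : kXinf :=
  xget 0 [set b | Id RB_relations (a - Xincl b)].

Definition diamond_w (a b : kXinf) : kXinf := phi (concat (Xincl a) (Xincl b)).

End OperatedIdeal.

Section Theta.
Variables X Omega : Type.

Fixpoint theta_letter (l : letter X Omega) : tree X Omega :=
  match l with
  | Var x => Leaf x
  | Bracket w u => Node w (map theta_letter u)
  end.

Fixpoint theta_inv_tree (t : tree X Omega) : letter X Omega :=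
  match t with
  | Leaf x => Var x
  | Node w f => Bracket w (map theta_inv_tree f)
  end.

Definition theta_word : word X Omega -> forest X Omega := map theta_letter.
Definition theta_inv_forest : forest X Omega -> word X Omega :=
  map theta_inv_tree.

Fixpoint theta_letterK (l : letter X Omega) :
  theta_inv_tree (theta_letter l) = l.
Proof.
case: l => [x|w u] //=; congr Bracket.
by elim: u => [//|l u IHu] /=; rewrite theta_letterK IHu.
Qed.

Fixpoint theta_inv_treeK (t : tree X Omega) :
  theta_letter (theta_inv_tree t) = t.
Proof.
case: t => [x|w f] //=; congr Node.
by elim: f => [//|t f IHf] /=; rewrite theta_inv_treeK IHf.
Qed.

Lemma theta_wordK : cancel theta_word theta_inv_forest.
Proof. exact: mapK theta_letterK. Qed.

Lemma theta_inv_forestK : cancel theta_inv_forest theta_word.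
Proof. exact: mapK theta_inv_treeK. Qed.

Local Open Scope classical_set_scope.

Definition Linf : set (forest X Omega) := theta_word @` @Xinf X Omega.

Definition theta_Xinf (w : set_type (@Xinf X Omega)) : set_type Linf :=
  SigSub (mem_set (ex_intro2 _ _ (val w) (set_mem (valP w)) erefl)).

Lemma theta_inv_Linf F : Linf F -> Xinf (theta_inv_forest F).
Proof. by move=> [w Xw <-]; rewrite theta_wordK. Qed.

Definition theta_inv_Xinf (F : set_type Linf) : set_type (@Xinf X Omega) :=
  SigSub (mem_set (theta_inv_Linf (set_mem (valP F)))).

Lemma Linf_nil : Linf [::].
Proof. by exists [::] => //; exact: Xinf_nil. Qed.

Lemma Linf_graft w F : Linf F -> Linf [:: Node w F].
Proof.
by move=> [u Xu <-]; exists [:: Bracket w u] => //; exact: Xinf_bracket.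
Qed.

Definition Linf_one : set_type Linf := SigSub (mem_set Linf_nil).

Definition graft_Linf (w : Omega) (F : set_type Linf) : set_type Linf :=
  SigSub (mem_set (Linf_graft w (set_mem (valP F)))).

End Theta.

Section Sha.
Variables (k : comPzRingType) (X Omega : Type) (lam : Omega -> k).
Notation kM := (freeMod k (word X Omega)).
Notation kF := (freeMod k (forest X Omega)).
Notation kXinf := (freeMod k (set_type (@Xinf X Omega))).

Definition Sha : lmodType k := freeMod k (set_type (@Linf X Omega)).

Definition theta_inv : kF -> kM :=
  linext (fun F => basis k (theta_inv_forest F)).
Definition theta_X : kXinf -> Sha := linext (fun w => basis k (theta_Xinf w)).
Definition theta_inv_X : Sha -> kXinf :=
  linext (fun F => basis k (theta_inv_Xinf F)).

Definition Sha_incl : Sha -> kF := linext (fun F => basis k (val F)).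

Definition psi (a : kF) : Sha := theta_X (phi lam (theta_inv a)).

Definition diamond_l (a b : Sha) : Sha :=
  theta_X (diamond_w lam (theta_inv_X a) (theta_inv_X b)).

Definition unit_l (c : k) : Sha := c *: basis k (@Linf_one X Omega).

Definition Delta_l (a : Sha)
    : freeMod k (set_type (@Linf X Omega) * set_type (@Linf X Omega))%type :=
  tensmap psi psi (Delta_RT (Sha_incl a)).

Definition eps_l : Sha -> k :=
  linext (fun F => (F == @Linf_one X Omega)%:R : k^o).

Definition Bplus (w : Omega) : Sha -> Sha :=
  linext (fun F => basis k (graft_Linf w F)).

End Sha.

(* Main.v *)
Require Import Defs.
From mathcomp Require Import all_boot all_algebra.
From HB Require Import structures.
From mathcomp Require Import finmap boolp classical_sets monalg.

Set Implicit Arguments.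
Unset Strict Implicit.
Unset Printing Implicit Defensive.

Import GRing.Theory.
Local Open Scope ring_scope.

(** Write kM for the algebra of bracketed words, kF for that of forests, and Id(S)
    for the operated ideal of Rota-Baxter relations. Once kM is known to be the
    direct sum of Id(S) and the span of the Rota-Baxter words, [psi] is a
    surjection of operated algebras from kF to Sha, and every statement about Sha
    can be checked on the classes psi(F) of arbitrary forests F, where the product
    is concatenation and the operators graft.

    The complement. Modulo Id(S) every word reduces to Rota-Baxter words; the point
    is that the result is unique. Instead of an associative product on the
    Rota-Baxter words, consider all linear operators on kM. For such an operator T
    let P_al(T) be the operator defined by recursion on words as follows, where
    [u]_al stands for the bracket of u:
      P_al(T)(1)        = [T(1)]_al
      P_al(T)(x v)      = [T(1)]_al x v                    (x a variable)
      P_al(T)([y]_be v) = ([T([y]_be)]_al + [P_al(T)(y)]_be + lam_be [T(y)]_al) v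
    This is how the bracket of T has to multiply if the Rota-Baxter relation is to
    hold. It makes the algebra of linear operators a matching Rota-Baxter algebra
    ([rb_opP], an induction on words), so that kM acts on itself through the
    quotient by Id(S) ([rho_Id]). The action of a on the empty word is congruent to
    a ([eqm_rho]), it is a combination of Rota-Baxter words ([rho_span]), and it is
    a itself if a already is one ([rho_Xincl]). This gives existence and uniqueness
    of the normal form, that is, the projection [phi].

    The bialgebra. The sum over subforests is computed by a recursion on forests
    ([cuts], [sum_lower]), which makes multiplicativity, the cocycle condition,
    coassociativity and the counit law identities between finite sums. The
    composite of psi (x) psi with Delta_RT kills Id(S): if a function of two forests
    satisfies the Rota-Baxter relation in each argument, so does its sum over the
    cuts ([RB_cuts]). Therefore the coproduct of psi(F) is the sum of psi (x) psi
    over the cuts of F ([Delta_class]), and the axioms follow from the identities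
    on forests.

    The antipode. Convolution of maps from forests to Sha is associative. The map
    j = e - psi, where e is the convolution unit, vanishes on the empty forest, and
    cutting preserves the number of vertices; hence the n-th convolution power of j
    vanishes on forests with fewer than n vertices, and the geometric series of j
    is a convolution inverse of psi. Each power factors through Sha, because the
    coproduct and psi do, and so does the series; the resulting endomorphism of Sha
    is the antipode. *)

(** * Linear maps out of free modules *)

Section FreeModuleTheory.
Variable k : comPzRingType.

Lemma linextE (B : choiceType) (M : lmodType k) (f : B -> M) (a : freeMod k B)
    (d : {fset B}) :
  (msupp a `<=` d)%fset -> linext f a = \sum_(x <- d) a@_x *: f x.
Proof.
move=> sad; rewrite /linext; apply: big_fset_incl => // x _ /mcoeff_outdom ->.
by rewrite scale0r.
Qed.

Fact linext_is_linear (B : choiceType) (M : lmodType k) (f : B -> M) :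
  linear (linext f).
Proof.
move=> c a b; pose d := (msupp a `|` msupp b `|` msupp (c *: a + b))%fset.
have [sa sb sab] : [/\ msupp a `<=` d, msupp b `<=` d
    & msupp (c *: a + b) `<=` d]%fset.
  by split; apply/fsubsetP => x xs; rewrite !inE xs ?orbT.
rewrite !(linextE _ (d := d)) // scaler_sumr -big_split /=.
apply: eq_bigr => x _; rewrite scalerA -scalerDl; congr (_ *: _).
by rewrite mcoeffD; congr (_ + _); exact: fmscaleE.
Qed.
HB.instance Definition _ (B : choiceType) (M : lmodType k) (f : B -> M) :=
  GRing.isLinear.Build k (freeMod k B) M *:%R (linext f) (linext_is_linear f).

Lemma linext_basis (B : choiceType) (M : lmodType k) (f : B -> M) x :
  linext f (basis k x) = f x.
Proof.
rewrite (linextE _ (msuppU_le (k := x) (x := 1))) big_seq_fset1.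
by rewrite mcoeffUU scale1r.
Qed.

Lemma free_ind (B : choiceType) (K : freeMod k B -> Prop) :
  (forall c a b, K a -> K b -> K (c *: a + b)) -> K 0 ->
  (forall x, K (basis k x)) -> forall a, K a.
Proof.
move=> KD K0 Kb a.
have -> : a = \sum_(x <- msupp a) a@_x *: basis k x.
  rewrite [LHS]monalgE; apply: eq_bigr => x _; apply/malgP => y.
  by rewrite [RHS]fmscaleE !mcoeffU [RHS]mulrnAr mulr1.
elim: (enum_fset _) => [|x s IHs]; rewrite ?big_nil // big_cons.
exact: KD.
Qed.

Section LinearMaps.
Variables U V W : lmodType k.

Lemma linear_comp (f : V -> W) (g : U -> V) :
  linear f -> linear g -> linear (fun a => f (g a)).
Proof. by move=> lf lg z a b; rewrite lg lf. Qed.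

Lemma linear_add (f g : U -> V) :
  linear f -> linear g -> linear (fun a => f a + g a).
Proof. by move=> lf lg z a b; rewrite lf lg scalerDr addrACA. Qed.

Lemma linear_scale l (f : U -> V) : linear f -> linear (fun a => l *: f a).
Proof. by move=> lf z a b; rewrite lf scalerDr !scalerA mulrC. Qed.

Lemma linear_map0 (f : U -> V) : linear f -> f 0 = 0.
Proof. by move=> /(_ (-1) 0 0); rewrite scaler0 addr0 scaleN1r addNr. Qed.

Lemma linear_mapZ (f : U -> V) z a : linear f -> f (z *: a) = z *: f a.
Proof. by move=> lf; rewrite -[z *: a]addr0 lf linear_map0 // addr0. Qed.

Lemma linear_mapB (f : U -> V) a b : linear f -> f (a - b) = f a - f b.
Proof. by move=> lf; rewrite -scaleN1r addrC lf scaleN1r addrC. Qed.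

Lemma linear_map_sum (f : U -> V) (I : Type) (r : seq I) (F : I -> U) :
  linear f -> f (\sum_(i <- r) F i) = \sum_(i <- r) f (F i).
Proof.
move=> lf; elim: r => [|i r IHr]; first by rewrite !big_nil linear_map0.
by rewrite !big_cons -IHr -[F i]scale1r lf !scale1r.
Qed.

End LinearMaps.

Lemma linear_ext (B : choiceType) (M : lmodType k) (f g : freeMod k B -> M) :
  linear f -> linear g -> (forall x, f (basis k x) = g (basis k x)) -> f =1 g.
Proof.
move=> lf lg fg; apply: free_ind => // [c a b fga fgb|].
  by rewrite lf lg fga fgb.
by rewrite !linear_map0.
Qed.

End FreeModuleTheory.

(** Abstracts the variable a on both sides of an equation before applying
    [linear_ext]; higher-order unification would choose other abstractions. *)
Ltac linear_ext_on a :=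
  lazymatch goal with |- ?L = ?R =>
    lazymatch eval pattern a in L with ?F _ =>
      lazymatch eval pattern a in R with ?G _ =>
        refine (@linear_ext _ _ _ F G _ _ _ a);
        [move=> ? ? ?; cbv beta | move=> ? ? ?; cbv beta
        | let x := fresh "x" in move=> x; cbv beta; move: x]
      end
    end
  end.

(** * Bilinear maps and the tensor product of free modules *)

Section TensorTheory.
Variable k : comPzRingType.

(** The exchange law behind the linearity in one argument of expressions that are
    linear in another. *)
Lemma lincomb2C (V : lmodType k) (c d : k) (x y u v : V) :
  c *: (d *: x + y) + (d *: u + v) = d *: (c *: x + u) + (c *: y + v).
Proof. by rewrite !scalerDr !scalerA mulrC addrACA. Qed.

Lemma linext2_linear (A B : choiceType) (M : lmodType k) (f : A -> B -> M) a :
  linear (fun b => linext (fun x => linext (f x) b) a).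
Proof.
move=> c x y; pose h b u := linext (f u) b.
apply: (linear_ext (g := fun a => c *: linext (h x) a + linext (h y) a)).
- exact: linearP.
- by move=> d u v; rewrite !(linearP (linext _)) lincomb2C.
by move=> i; rewrite /h !linext_basis linearP.
Qed.

Section Bilinear.
Variables A B C D : choiceType.

HB.instance Definition _ (f : freeMod k A -> freeMod k C)
  (g : freeMod k B -> freeMod k D) :=
  GRing.Linear.copy (tensmap f g) (linext _).
HB.instance Definition _ := GRing.Linear.copy (@tensA k A B C) (linext _).

Lemma tensbb (x : A) (y : B) :
  tens (basis k x) (basis k y) = basis k (x, y).
Proof. by rewrite /tens !linext_basis. Qed.

Fact tensPl (b : freeMod k B) : linear ((@tens k A B)^~ b).
Proof. by move=> c x y; rewrite /tens linearP. Qed.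
Fact tensPr (a : freeMod k A) : linear (@tens k A B a).
Proof. exact: linext2_linear. Qed.
HB.instance Definition _ (a : freeMod k A) :=
  GRing.isLinear.Build k (freeMod k B) (freeMod k (A * B)%type) *:%R
    (@tens k A B a) (tensPr a).

Lemma tens_suml (I : Type) (r : seq I) (F : I -> freeMod k A) (b : freeMod k B) :
  tens (\sum_(i <- r) F i) b = \sum_(i <- r) tens (F i) b.
Proof.
elim: r => [|i r IHr]; first by rewrite !big_nil /tens linear0.
by rewrite !big_cons -IHr -[F i]scale1r tensPl !scale1r.
Qed.

(** Universal property of the tensor product, for a bilinear map given on basis
    elements. *)
Lemma tens_linext (M : lmodType k) (f : A -> B -> M) a b :
  linext (fun p => f p.1 p.2) (tens a b) = linext (fun x => linext (f x) b) a.
Proof.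
apply: (linear_ext (f := fun a => linext _ (tens a b))) => [c x y||x].
- by rewrite tensPl linearP.
- exact: linearP.
rewrite linext_basis.
apply: (linear_ext (f := fun b => linext _ (tens _ b))) => [c u v||y].
- by rewrite !linearP.
- exact: linearP.
by rewrite tensbb !linext_basis.
Qed.

Lemma bilinear_tens (M : lmodType k) (h : freeMod k A -> freeMod k B -> M) a b :
  (forall b, linear (h^~ b)) -> (forall a, linear (h a)) ->
  linext (fun p => h (basis k p.1) (basis k p.2)) (tens a b) = h a b.
Proof.
move=> hl hr; rewrite (tens_linext (fun x y => h (basis k x) (basis k y))).
apply: (linear_ext (g := h^~ b)) => [||x]; [exact: linearP|exact: hl|].
rewrite linext_basis; apply: (linear_ext (g := h _)) => [||y].
- exact: linearP.
- exact: hr.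
by rewrite linext_basis.
Qed.

End Bilinear.

Lemma tensmap_tens (A B C D : choiceType) (f : freeMod k A -> freeMod k C)
    (g : freeMod k B -> freeMod k D) a b :
  linear f -> linear g -> tensmap f g (tens a b) = tens (f a) (g b).
Proof.
move=> lf lg; rewrite /tensmap.
rewrite (bilinear_tens (h := fun a b => tens (f a) (g b))) //.
- by move=> {}b c x y /=; rewrite lf tensPl.
- by move=> {}a c x y /=; rewrite lg linearP.
Qed.

Lemma tensA_tens (A B C : choiceType) (a : freeMod k A) (b : freeMod k B)
    (c : freeMod k C) :
  tensA (tens (tens a b) c) = tens a (tens b c).
Proof.
rewrite /tensA (tens_linext (fun p z => basis k (p.1, (p.2, z)))).
rewrite (tens_linext (fun x y => linext (fun z => basis k (x, (y, z))) c)).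
congr (linext _ a); apply/funext => x.
rewrite -(tens_linext (fun y z => basis k (x, (y, z)))).
by congr (linext _ (tens b c)); apply/funext => -[].
Qed.

Section Multiplication.
Variables (B : choiceType) (mul : freeMod k B -> freeMod k B -> freeMod k B).
Hypotheses (mulPl : forall b, linear (mul^~ b)) (mulPr : forall a, linear (mul a)).

Lemma multens_tens a b : multens mul (tens a b) = mul a b.
Proof. exact: bilinear_tens. Qed.

Lemma multens_linear : linear (multens mul).
Proof. by move=> z a b; exact: linearP. Qed.

Lemma tensmulPl t : linear ((tensmul mul)^~ t).
Proof. by move=> z a b; exact: linearP. Qed.

Lemma tensmulPr s : linear (tensmul mul s).
Proof. exact: linext2_linear. Qed.

Lemma tensmul_tens a b c d :
  tensmul mul (tens a b) (tens c d) = tens (mul a c) (mul b d).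
Proof.
have inner x y : linext (fun q => tens (mul (basis k x) (basis k q.1))
    (mul (basis k y) (basis k q.2))) (tens c d) =
    tens (mul (basis k x) c) (mul (basis k y) d).
  apply: (bilinear_tens (h := fun c d => tens (mul _ c) (mul _ d))) => e.
    exact: (linear_comp (tensPl _) (mulPr _)).
  exact: (linear_comp (tensPr _) (mulPr _)).
transitivity (linext (fun p => tens (mul (basis k p.1) c) (mul (basis k p.2) d))
    (tens a b)).
  by congr (linext _ (tens a b)); apply/funext => p; exact: inner.
apply: (bilinear_tens (h := fun a b => tens (mul a c) (mul b d))) => e.
  exact: (linear_comp (tensPl _) (mulPl _)).
exact: (linear_comp (tensPr _) (mulPl _)).
Qed.

End Multiplication.

End TensorTheory.

(** * Rota-Baxter words *)

Section WordInduction.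
Variables X Omega : Type.
Notation word := (word X Omega).

Lemma word_ind (K : word -> Prop) :
  K [::] -> (forall x v, K v -> K (Var x :: v)) ->
  (forall w u v, K u -> K v -> K (Bracket w u :: v)) -> forall v, K v.
Proof.
move=> K0 Kx Kb.
suff Kl : forall l v, K v -> K (l :: v) by elim=> // l v; exact: Kl.
fix IHl 1 => -[x|w u] v Kv; first exact: Kx.
apply: Kb => //; elim: u => [|l u IHu]; first exact: K0.
exact: IHl.
Qed.

Definition var_start (v : word) : bool :=
  if v is Bracket _ _ :: _ then false else true.

(** The Rota-Baxter words: at every depth, a bracket is never followed by a
    bracket. The inner fixpoint repeats [nf], since the recursion passes through
    the lists nested in letters. *)
Fixpoint nf_letter (l : letter X Omega) : bool :=
  if l is Bracket _ u then
    (fix nf (v : word) : bool :=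
       if v is l :: v' then
         [&& nf_letter l, nf v' & if l is Bracket _ _ then var_start v' else true]
       else true) u
  else true.

Fixpoint nf (v : word) : bool :=
  if v is l :: v' then
    [&& nf_letter l, nf v' & if l is Bracket _ _ then var_start v' else true]
  else true.

Lemma nf_Var x v : nf (Var x :: v) = nf v.
Proof. by rewrite /= andbT. Qed.

Lemma nf_Bracket w u v : nf (Bracket w u :: v) = [&& nf u, nf v & var_start v].
Proof. by []. Qed.

End WordInduction.

(** * The algebra of bracketed words *)

Section Concatenation.
Variables (k : comPzRingType) (X Omega : Type).
Notation word := (word X Omega).
Notation kM := (freeMod k word).
Implicit Types a b c : kM.

Lemma concatPl b : linear ((@concat k X Omega)^~ b).
Proof. by move=> c x y; rewrite /concat linearP. Qed.
HB.instance Definition _ a := GRing.isLinear.Build k kM kM *:%R (concat a)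
  (linext2_linear (fun u v => basis k (u ++ v)) a).
HB.instance Definition _ w :=
  GRing.Linear.copy (@bracket k X Omega w) (linext _).

Lemma concat_basis u v :
  concat (basis k u) (basis k v) = basis k (u ++ v : word).
Proof. by rewrite /concat !linext_basis. Qed.

Lemma bracket_basis w u :
  bracket w (basis k u) = basis k ([:: Bracket w u] : word).
Proof. exact: linext_basis. Qed.

Lemma bracketP w z a b :
  bracket w (z *: a + b) = z *: bracket w a + bracket w b.
Proof. exact: linearP. Qed.

Lemma concatPr a : linear (concat a).
Proof. exact: linearP. Qed.

Lemma concatDl a b c : concat (a + b) c = concat a c + concat b c.
Proof. by rewrite -[a]scale1r concatPl !scale1r. Qed.

Lemma concatBl a b c : concat (a - b) c = concat a c - concat b c.
Proof. by rewrite -scaleN1r addrC concatPl scaleN1r addrC. Qed.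

Lemma concatA a b c : concat a (concat b c) = concat (concat a b) c.
Proof.
linear_ext_on a => [||u]; rewrite ?concatPl //.
linear_ext_on b => [||v]; rewrite ?(concatPl, linearP) //.
linear_ext_on c => [||w]; rewrite ?linearP //.
by rewrite !concat_basis catA.
Qed.

Lemma concat1l a : concat (basis k [::]) a = a.
Proof.
by apply: (linear_ext (f := concat _) (g := id)) => [|//|u];
  [exact: linearP | rewrite concat_basis].
Qed.

Lemma concat1r a : concat a (basis k [::]) = a.
Proof.
by apply: (linear_ext (f := (@concat k X Omega)^~ _) (g := id)) => [|//|u];
  [exact: concatPl | rewrite concat_basis cats0].
Qed.

End Concatenation.

(** The two lemmas below handle the shape of the right-hand side of the
    Rota-Baxter relation. They are stated over an arbitrary module, where
    associativity and commutativity are decided without unfolding sums. *)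
Lemma lincomb3P (k : comPzRingType) (V : lmodType k) (z l : k)
    (a a' b b' c c' : V) :
  (z *: a + a') + (z *: b + b') + l *: (z *: c + c') =
  z *: (a + b + l *: c) + (a' + b' + l *: c').
Proof. by rewrite !scalerDr !scalerA (mulrC l) (AC (2*2*2) (1*3*5*(2*4*6))). Qed.

Lemma linear3 (k : comPzRingType) (U V : lmodType k) (f : U -> V) z a b c :
  linear f -> f (a + b + z *: c) = f a + f b + z *: f c.
Proof.
move=> lf; rewrite addrC lf addrC; congr (_ + _).
by rewrite -[a]scale1r lf !scale1r.
Qed.

(** * Operators on bracketed words as a Rota-Baxter algebra *)

Section Operators.
Variables (k : comPzRingType) (X Omega : Type) (lam : Omega -> k).
Notation letter := (letter X Omega).
Notation word := (word X Omega).
Notation kM := (freeMod k word).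
Notation "[ 'w' v ]" := (basis k (v : word)) (format "[ 'w'  v ]").

Section RBOperator.
Variables (al : Omega) (T : kM -> kM).

(** [rb_op al T] is the operator P_al(T) of the introduction. Only the first letter
    of a word matters, and [rb_letter] is what that letter becomes. *)
Fixpoint rb_letter (l : letter) : kM :=
  match l with
  | Var x => concat (bracket al (T [w [::]])) [w [:: Var x]]
  | Bracket be y =>
      bracket al (T [w [:: Bracket be y]])
      + bracket be (if y is m :: y' then concat (rb_letter m) [w y']
                    else bracket al (T [w [::]]))
      + lam be *: bracket al (T [w y])
  end.

Definition rb_word (v : word) : kM :=
  if v is l :: v' then concat (rb_letter l) [w v'] else bracket al (T [w [::]]).

Definition rb_op : kM -> kM := linext rb_word.
HB.instance Definition _ := GRing.Linear.copy rb_op (linext rb_word).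

Lemma rb_op_nil : rb_op [w [::]] = bracket al (T [w [::]]).
Proof. by rewrite /rb_op linext_basis. Qed.

Lemma rb_op_Var x v :
  rb_op [w Var x :: v] = concat (bracket al (T [w [::]])) [w Var x :: v].
Proof. by rewrite /rb_op linext_basis /= -concatA concat_basis. Qed.

Lemma rb_op_Bracket be y v :
  rb_op [w Bracket be y :: v] =
  concat (bracket al (T [w [:: Bracket be y]]) + bracket be (rb_op [w y])
          + lam be *: bracket al (T [w y])) [w v].
Proof. by rewrite /rb_op !linext_basis. Qed.

Lemma rb_op_Bracket1 be y :
  rb_op [w [:: Bracket be y]] =
  bracket al (T [w [:: Bracket be y]]) + bracket be (rb_op [w y])
  + lam be *: bracket al (T [w y]).
Proof. by rewrite rb_op_Bracket; exact: concat1r. Qed.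

End RBOperator.

Lemma rb_op_linear al T z a b :
  rb_op al T (z *: a + b) = z *: rb_op al T a + rb_op al T b.
Proof. exact: linearP. Qed.

(** The recursive clause of [rb_op] is linear in the content of the bracket. *)
Lemma rb_op_bracket al (T : kM -> kM) be a v : linear T ->
  rb_op al T (concat (bracket be a) [w v]) =
  concat (bracket al (T (bracket be a)) + bracket be (rb_op al T a)
          + lam be *: bracket al (T a)) [w v].
Proof.
move=> lT; linear_ext_on a => [||y].
- by rewrite bracketP concatPl rb_op_linear.
- rewrite -concatPl; congr concat.
  by rewrite !(bracketP, lT, rb_op_linear) lincomb3P.
by rewrite bracket_basis concat_basis -rb_op_Bracket.
Qed.

(** The inductive step of [rb_opP] at a word that starts with a bracket: C appends
    the rest of the word, and q is the image of the content of the bracket, to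
    which the induction hypothesis applies. Each side has eleven terms. *)
Lemma rb_step (V : lmodType k) (C Bal Bbe Bga R T : V -> V) (lbe lga : k)
    (p q r A1 A2 A3 : V) :
  linear C -> linear Bal -> linear Bbe -> linear Bga -> linear R -> linear T ->
  (forall a, R (C (Bbe a)) =
     C (Bal (T (Bbe a)) + Bbe (R a) + lbe *: Bal (T a))) ->
  (forall a, R (C (Bga a)) =
     C (Bal (T (Bga a)) + Bga (R a) + lga *: Bal (T a))) ->
  R q = A1 + A2 + lbe *: A3 ->
  R (C (Bbe p + Bga q + lga *: Bbe r)) =
    C (Bal (T (Bbe p + Bga q + lga *: Bbe r)) + Bga A1 + lga *: Bal (T q))
    + C (Bbe (R p) + Bga A2 + lga *: Bbe (R r))
    + lbe *: C (Bal (T p) + Bga A3 + lga *: Bal (T r)).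
Proof.
move=> lC lBal lBbe lBga lR lT RBbe RBga Rq.
rewrite !(linear3 _ _ _ _ lC) (linear3 _ _ _ _ lR) !RBbe RBga Rq.
rewrite (linear3 _ _ _ _ lT) !(linear3 _ _ _ _ lBal) (linear3 _ _ _ _ lBga).
rewrite !(linear3 _ _ _ _ lC) !scalerDr !scalerA (mulrC lga).
(* The numbers refer to the terms of the left-hand side, in their order. *)
by rewrite (AC (3*(1*3*1)*3) (1*4*9*5*8*(2*6*10)*(3*7*11))).
Qed.

(** The linear operators form a matching Rota-Baxter algebra under composition.
    On the empty word and on words starting with a variable the relation is the
    definition of [rb_op]; at a bracket, expanding both sides leaves the relation
    on the content of that bracket. *)
Lemma rb_opP al be (T U : kM -> kM) a : linear T -> linear U ->
  rb_op al T (rb_op be U a) =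
  rb_op al (T \o rb_op be U) a + rb_op be (rb_op al T \o U) a
  + lam be *: rb_op al (T \o U) a.
Proof.
move=> lT lU; linear_ext_on a => [||v].
- by rewrite !rb_op_linear.
- by rewrite !rb_op_linear lincomb3P.
elim/word_ind: v => [|x v _|ga z v IHz _].
- rewrite !rb_op_nil -[bracket be _]concat1r rb_op_bracket // concat1r.
  by rewrite /= !rb_op_nil.
- rewrite !rb_op_Var rb_op_bracket //= !rb_op_nil.
  exact: (linear3 _ _ _ _ (concatPl _)).
rewrite 4!rb_op_Bracket /comp rb_op_Bracket1.
apply: (rb_step (C := (@concat k X Omega)^~ _) (Bal := bracket al)
  (Bbe := bracket be) (Bga := bracket ga) (R := rb_op al T) (T := T)).
- exact: concatPl.
- exact: bracketP.
- exact: bracketP.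
- exact: bracketP.
- exact: rb_op_linear.
- exact: lT.
- by move=> ?; exact: rb_op_bracket.
- by move=> ?; exact: rb_op_bracket.
- exact: IHz.
Qed.

Lemma rb_op_oplinear al z (T U : kM -> kM) a :
  rb_op al (fun b => z *: T b + U b) a = z *: rb_op al T a + rb_op al U a.
Proof.
linear_ext_on a => [||v].
- exact: rb_op_linear.
- rewrite 2!rb_op_linear; exact: lincomb2C.
elim/word_ind: v => [|x v _|be y v IHy _].
- by rewrite !rb_op_nil bracketP.
- by rewrite !rb_op_Var bracketP concatPl.
rewrite 3!rb_op_Bracket -concatPl IHy 3!bracketP; congr (concat _ _).
exact: lincomb3P.
Qed.

(** The representation of the algebra of bracketed words that sends a variable to
    left concatenation and the bracketing operators to [rb_op]. *)
Fixpoint act_letter (l : letter) : kM -> kM :=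
  match l with
  | Var x => concat [w [:: Var x]]
  | Bracket om u => rb_op om (foldr (fun m f => act_letter m \o f) id u)
  end.

Definition act (u : word) : kM -> kM :=
  foldr (fun m f => act_letter m \o f) id u.

Lemma act_cat u v : act (u ++ v) = act u \o act v.
Proof. by elim: u => [//|l u IHu] /=; rewrite IHu. Qed.

Lemma act_Bracket om u v : act (Bracket om u :: v) = rb_op om (act u) \o act v.
Proof. by []. Qed.

Lemma act_linear u : linear (act u).
Proof.
elim: u => [//|l u IHu] z a b /=; rewrite IHu.
by case: l => [x|om u'] /=; exact: linearP.
Qed.

Definition rho (a b : kM) : kM := linext (fun u => act u b) a.

Lemma rho_basis u b : rho [w u] b = act u b.
Proof. exact: linext_basis. Qed.

Lemma rhoPl z a b c : rho (z *: a + b) c = z *: rho a c + rho b c.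
Proof. exact: linearP. Qed.

Lemma rhoPr a : linear (rho a).
Proof.
move=> z b c; linear_ext_on a => [||u].
- exact: rhoPl.
- by rewrite !rhoPl lincomb2C.
by rewrite !rho_basis act_linear.
Qed.

Lemma rho_concat a b c : rho (concat a b) c = rho a (rho b c).
Proof.
linear_ext_on a => [||u].
- by rewrite concatPl rhoPl.
- exact: rhoPl.
linear_ext_on b => [||v].
- by rewrite linearP rhoPl.
- by rewrite rhoPl rhoPr.
by rewrite concat_basis !rho_basis act_cat.
Qed.

Lemma rho_bracket om a b : rho (bracket om a) b = rb_op om (rho a) b.
Proof.
have rhoE z x y : rho (z *: x + y) = fun c => z *: rho x c + rho y c.
  by apply/funext => c; exact: rhoPl.
linear_ext_on a => [||u].
- by rewrite bracketP rhoPl.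
- by rewrite rhoE; exact: rb_op_oplinear.
have rhoE1 : rho [w u] = act u by apply/funext => c; exact: rho_basis.
by rewrite bracket_basis rho_basis rhoE1.
Qed.
End Operators.

(** * Rota-Baxter words as alternating products *)

Section NormalForms.
Variables X Omega : Type.
Notation letter := (letter X Omega).
Notation word := (word X Omega).
Local Open Scope classical_set_scope.

(** The products of factors taken alternately in P and in Q, starting with P. *)
Definition alternating (P Q : set word) (v : word) : Prop :=
  (exists r, powset (prodset P Q) r.+1 v) \/
  (exists r, prodset (powset (prodset P Q) r) P v).

Lemma powset_rcons (U : set word) r u v :
  powset U r u -> U v -> powset U r.+1 (u ++ v).
Proof.
elim: r u => [|r IHr] u.
  by move=> /= -> Uv; exists v => //; exists [::] => //; rewrite cats0.
move=> [u1 Uu1 [u2 Uu2 <-]] Uv; exists u1 => //.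
by exists (u2 ++ v); [exact: IHr | rewrite catA].
Qed.

(** The identity (P Q)^r P = P (Q P)^r, which moves a factor across the powers in
    the definition of [Lambda]. *)
Lemma powset_shift (P Q : set word) r p v :
  P p -> powset (prodset Q P) r v -> prodset (powset (prodset P Q) r) P (p ++ v).
Proof.
elim: r p v => [|r IHr] p v Pp.
  by move=> /= ->; exists [::] => //; exists p => //; rewrite cats0.
move=> [_ [q Qq [p' Pp' <-]] [v' Pv' <-]].
have [u Uu [p'' Pp'' eq_v]] := IHr _ _ Pp' Pv'.
exists (p ++ q ++ u).
  by exists (p ++ q); [exists p => //; exists q | exists u => //; rewrite catA].
by exists p'' => //; rewrite -!catA eq_v.
Qed.

(** Peeling off the first factor turns the four families of powers in [Lambda] into
    a recursive description. *)
Lemma alternatingP (P Q : set word) v :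
  alternating P Q v <->
  exists p v', [/\ P p, v' = [::] \/ alternating Q P v' & v = p ++ v'].
Proof.
split=> [[[r]|[r]]|].
- move=> [_ [p Pp [q Qq <-]] [v' Uv' <-]]; exists p, (q ++ v'); split=> //.
    by right; right; exists r; exact: powset_shift.
  by rewrite catA.
- case: r => [|r].
    move=> [_ -> [p Pp <-]]; exists p, [::].
    by split; [|left|rewrite cats0].
  move=> [_ [_ [p Pp [q Qq <-]] [u Uu <-]] [p' Pp' <-]].
  exists p, (q ++ u ++ p'); split=> //; last by rewrite !catA.
  right; left; exists r.
  have [u' Uu' [q' Qq' eq_u]] := powset_shift Qq Uu.
  rewrite catA -eq_u -catA; apply: powset_rcons => //.
  by exists q' => //; exists p'.
move=> [p [v' [Pp v'P ->]]]; case: v'P => [->|[[r]|[r]]].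
- by right; exists 0%N; exists [::] => //; exists p => //; rewrite cats0.
- by move=> Uv'; right; exists r.+1; exact: powset_shift.
move=> [u Uu [q Qq <-]]; left; exists r.
have [u' Uu' [p' Pp' eq_u]] := powset_shift Pp Uu.
rewrite catA -eq_u -catA; apply: powset_rcons => //.
by exists p' => //; exists q.
Qed.

Notation Y := (@free_semigroup X Omega).

Lemma LambdaP (Z : set word) v :
  Lambda Y Z v <->
  [\/ alternating Y (brackets Z) v, alternating (brackets Z) Y v | v = [::]].
Proof.
split.
  case=> [[[[[[//|r] _ Uv]|[r _ Uv]]|[[//|r] _ Uv]]|[r _ Uv]]|->].
  - by constructor 1; left; exists r.
  - by constructor 1; right; exists r.
  - by constructor 2; left; exists r.
  - by constructor 2; right; exists r.
  - by constructor 3.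
case=> [[[r Uv]|[r Uv]]|[[r Uv]|[r Uv]]|->].
- by left; left; left; left; exists r.+1.
- by left; left; left; right; exists r.
- by left; left; right; exists r.+1.
- by left; right; exists r.
- by right.
Qed.

Lemma nf_cat_Var s v : nf (map Var s ++ v : word) = nf v.
Proof. by elim: s => [//|x s IHs] /=; rewrite IHs andbT. Qed.

(** By induction on the length, as peeling off a factor exchanges the two kinds of
    alternating products. *)
Lemma alternating_nf (Z : set word) n v :
  (forall u, Z u -> nf u) -> (size v <= n)%N ->
  (alternating Y (brackets Z) v -> nf v && var_start v) /\
  (alternating (brackets Z) Y v -> nf v).
Proof.
move=> Znf; elim: n v => [|n IHn] v sv.
  split=> /alternatingP [p [v' [Pp _ eq_v]]]; move: sv; rewrite {}eq_v.
  - by case: Pp => -[|x s] //= _ <-.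
  - by case: Pp => om _ [u Zu <-].
split=> /alternatingP [p [v' [Pp v'P eq_v]]]; move: sv; rewrite {}eq_v.
- case: Pp => -[|x s] //= s0 <-; rewrite ltnS /= nf_cat_Var andbT => sv.
  have [|_ aZY] := IHn v'; last by case: v'P => [-> //|/aZY ->].
  apply: (leq_trans _ (sv : size (map Var s ++ v') <= n)%N).
  by rewrite size_cat leq_addl.
case: Pp => om _ [u Zu <-]; rewrite cat1s [size _]/= ltnS nf_Bracket Znf //= => sv.
by case: v'P => [-> //|]; have [aYZ _] := IHn v' sv; exact: aYZ.
Qed.

Lemma Xn_nf n (v : word) : Xn n v -> nf v.
Proof.
elim: n v => [|n IHn] v /=.
  by move=> [s _ <-]; rewrite -[map _ _]cats0 nf_cat_Var.
have [aYZ aZY] := alternating_nf (Z := Xn n) IHn (leqnn (size v)).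
by move=> /LambdaP [/aYZ/andP[]//|/aZY//|->].
Qed.

(** The rank of the stage of the union [Xinf] that contains a word is read off the
    nesting depth of its brackets. *)
Fixpoint depth_letter (l : letter) : nat :=
  if l is Bracket _ u then (\max_(d <- map depth_letter u) d).+1 else 0.

Lemma depth_Bracket w u n :
  (depth_letter (Bracket w u) <= n.+1)%N =
  all (fun l => depth_letter l <= n)%N u.
Proof.
rewrite /= ltnS; elim: u => [|l u IHu] /=; first by rewrite big_nil.
by rewrite big_cons geq_max IHu.
Qed.

Lemma nf_alternating (Z : set word) v :
  (forall om u, Bracket om u \in v -> Z u) -> nf v ->
  [\/ v = [::], var_start v /\ alternating Y (brackets Z) v |
      alternating (brackets Z) Y v].
Proof.
elim: v => [|l v IHv] Zv; first by constructor 1.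
have {}IHv : nf v -> _ :=
  IHv (fun om u iv => Zv om u (mem_behead (s := l :: v) iv)).
case: l Zv => [x|om u] Zv.
- rewrite nf_Var => /IHv vP.
  constructor 2; split=> //; apply/alternatingP.
  case: vP => [->|[_ /alternatingP [p [v' [[s s0 <-] v'P ->]]]]|aZY].
  + by exists [:: Var x], [::]; split; [exists [:: x]|left|].
  + by exists (Var x :: map Var s), v'; split; [exists (x :: s)| |].
  + by exists [:: Var x], v; split; [exists [:: x]|right|].
rewrite nf_Bracket => /and3P [nfu nfv sv].
constructor 3; apply/alternatingP; exists [:: Bracket om u], v; split=> //.
  by exists om => //; exists u => //; apply: (Zv om); exact: mem_head.
case: (IHv nfv) => [->|[_ aYZ]|/alternatingP [p [v' [[om' _ [u' _ <-]] _ eq_v]]]].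
- by left.
- by right.
- by move: sv; rewrite eq_v.
Qed.

Lemma nf_Xn n (v : word) : nf v -> all (fun l => depth_letter l <= n)%N v -> Xn n v.
Proof.
elim: n v => [|n IHn] v nfv dv.
  elim: v dv nfv => [_ _|[x|//] v IHv /= dv]; first by exists [::].
  by rewrite andbT => /(IHv dv) [s _ <-]; exists (x :: s).
apply/LambdaP; have Zv om u : Bracket om u \in v -> Xn n u.
  elim: v nfv dv => [//|l v IHv] /= /and3P [nfl nfv _] /andP [dl dv].
  rewrite in_cons => /orP [/eqP eq_l|]; last exact: IHv.
  by move: nfl dl; rewrite -eq_l depth_Bracket => nfu; exact: IHn.
have [->|[_ a]|a] := nf_alternating Zv nfv.
- by constructor 3.
- by constructor 1.
by constructor 2.
Qed.

Lemma XinfP (v : word) : Xinf v <-> nf v.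
Proof.
split=> [[n _]|nfv]; first exact: Xn_nf.
exists (\max_(d <- map depth_letter v) d) => //; apply: nf_Xn => //.
elim: v {nfv} => [//|l v IHv] /=; rewrite big_cons leq_maxl /=.
by apply: sub_all IHv => m; move/leq_trans; apply; exact: leq_maxr.
Qed.

End NormalForms.

(** * The complement of the operated ideal *)

Section Reduction.
Variables (k : comPzRingType) (X Omega : Type) (lam : Omega -> k).
Notation word := (word X Omega).
Notation kM := (freeMod k word).
Notation "[ 'w' v ]" := (basis k (v : word)) (format "[ 'w'  v ]").
Notation kXinf := (freeMod k (set_type (@Xinf X Omega))).
Notation RB := (RB_relations lam).
Notation rb_op := (@rb_op k X Omega lam).

HB.instance Definition _ := GRing.Linear.copy (@Xincl k X Omega) (linext _).

Definition nf_span (a : kM) : Prop := exists b : kXinf, a = Xincl b.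

Lemma nf_spanP z a b : nf_span a -> nf_span b -> nf_span (z *: a + b).
Proof.
move=> [a' ->] [b' ->]; exists (z *: a' + b'); symmetry; exact: linearP.
Qed.

Lemma nf_span_basis u : nf u -> nf_span [w u].
Proof.
move=> /XinfP Xu; exists (basis k (SigSub (mem_set Xu))).
by symmetry; exact: linext_basis.
Qed.

Lemma nf_span_map (f : kM -> kM) a : linear f ->
  (forall u, nf u -> nf_span (f [w u])) -> nf_span a -> nf_span (f a).
Proof.
move=> lf fnf [b ->]; pattern b; apply: free_ind => [z x y Kx Ky||[u Xu]].
- have -> : Xincl (z *: x + y) = z *: Xincl x + Xincl y by exact: linearP.
  by rewrite lf; exact: nf_spanP.
- have -> : Xincl (0 : kXinf) = 0 by exact: linear0.
  rewrite (linear_map0 lf).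
  by exists 0; symmetry; exact: linear0.
have -> : Xincl (basis k (exist _ u Xu : set_type _)) = [w u].
  exact: linext_basis.
by apply: fnf; apply/XinfP; exact: set_mem.
Qed.

Lemma nf_span_add a b : nf_span a -> nf_span b -> nf_span (a + b).
Proof. by move=> sa sb; rewrite -[a]scale1r; exact: nf_spanP. Qed.

(** The only way in which the recursion for [rb_op] creates a bracket in front of
    other letters. *)
Lemma nf_span_bracket om a v : nf v -> var_start v -> nf_span a ->
  nf_span (concat (bracket om a) [w v]).
Proof.
move=> nfv sv.
apply: (nf_span_map (f := fun a => concat (bracket om a) _)) => [z x y|u nfu].
  by rewrite bracketP concatPl.
rewrite bracket_basis concat_basis; apply: nf_span_basis.
by rewrite nf_Bracket nfu nfv.
Qed.

Lemma rb_op_span al (T : kM -> kM) :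
  (forall a, nf_span a -> nf_span (T a)) ->
  forall a, nf_span a -> nf_span (rb_op al T a).
Proof.
move=> sT; have sT1 u : nf u -> nf_span (T [w u]).
  by move=> nfu; apply: sT; exact: nf_span_basis.
move=> a; apply: nf_span_map => [|v]; first exact: rb_op_linear.
elim/word_ind: v => [_|x v _ nfv|be y v IHy _].
- rewrite rb_op_nil -[bracket _ _]concat1r.
  by apply: nf_span_bracket => //; exact: sT1.
- by rewrite rb_op_Var; apply: nf_span_bracket => //; exact: sT1.
rewrite nf_Bracket => /and3P [nfy nfv sv]; rewrite rb_op_Bracket.
rewrite addrC concatPl; apply: nf_spanP; last rewrite concatDl.
  by apply: nf_span_bracket => //; exact: sT1.
apply: nf_span_add; apply: nf_span_bracket => //; last exact: IHy.
by apply: sT1; rewrite nf_Bracket nfy.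
Qed.

Lemma act_span u a : nf_span a -> nf_span (act lam u a).
Proof.
elim/word_ind: u a => [//|x v IHv|om u v IHu IHv] a sa.
- rewrite /=; apply: nf_span_map (IHv _ sa) => [|u nfu]; first exact: linearP.
  by rewrite concat_basis; apply: nf_span_basis; rewrite nf_Var.
by rewrite act_Bracket; apply: rb_op_span; [exact: IHu | exact: IHv].
Qed.

Lemma rho_span a b : nf_span b -> nf_span (rho lam a b).
Proof.
move=> sb; pattern a; apply: free_ind => [z x y sx sy||u].
- by rewrite rhoPl; exact: nf_spanP.
- by exists 0; rewrite /rho !linear0.
by rewrite rho_basis; exact: act_span.
Qed.

(** On a Rota-Baxter word no rewriting takes place: each bracket acts on a word
    that is empty or starts with a variable. *)
Lemma act_nf u : nf u -> act lam u [w [::]] = [w u].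
Proof.
elim/word_ind: u => [//|x v IHv|om u v IHu IHv].
- by rewrite nf_Var => /IHv /= ->; rewrite concat_basis.
rewrite nf_Bracket => /and3P [/IHu u1 /IHv v1]; rewrite act_Bracket /= v1.
case: v {IHv v1} => [_|[x|//] v _].
  by rewrite rb_op_nil u1 bracket_basis.
by rewrite rb_op_Var u1 bracket_basis concat_basis.
Qed.

Lemma rho_Xincl (b : kXinf) : rho lam (Xincl b) [w [::]] = Xincl b.
Proof.
linear_ext_on b => [||[u Xu]].
- by rewrite linearP rhoPl.
- exact: linearP.
have -> : Xincl (basis k (exist _ u Xu : set_type _)) = [w u].
  exact: linext_basis.
by rewrite rho_basis act_nf //; apply/XinfP; exact: set_mem.
Qed.

Lemma Xincl_inj : injective (@Xincl k X Omega).
Proof.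
pose proj : kM -> kXinf :=
  linext (fun u => if insub u is Some v then basis k v else 0).
suff projK : cancel (@Xincl k X Omega) proj by exact: can_inj projK.
move=> b; linear_ext_on b => [||v].
- by rewrite linearP; exact: linearP.
- by [].
have -> : Xincl (basis k v) = [w val v] by exact: linext_basis.
by rewrite [LHS]linext_basis valK.
Qed.

Lemma Id_ideal S : is_operated_ideal (Id S : set kM).
Proof.
split.
- by move=> I [].
- by move=> a b Ia Ib I iI SI; apply: operated_idealD => //; [exact: Ia|exact: Ib].
- by move=> c a Ia I iI SI; apply: operated_idealZ => //; exact: Ia.
- by move=> a b Ib I iI SI; apply: operated_idealMl => //; exact: Ib.
- by move=> a b Ia I iI SI; apply: operated_idealMr => //; exact: Ia.
- by move=> w a Ia I iI SI; apply: operated_idealP => //; exact: Ia.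
Qed.

Definition eqm (a b : kM) : Prop := Id RB (a - b).

Lemma eqm_refl a : eqm a a.
Proof. by rewrite /eqm subrr; exact: (operated_ideal0 (Id_ideal _)). Qed.

Lemma eqm_sym a b : eqm a b -> eqm b a.
Proof.
by move=> /(operated_idealZ (Id_ideal _) (-1)); rewrite scaleN1r opprB.
Qed.

Lemma eqm_trans a b c : eqm a b -> eqm b c -> eqm a c.
Proof.
rewrite /eqm => ab bc; rewrite -(subrKA b); exact: (operated_idealD (Id_ideal _)).
Qed.

Lemma eqmP z a b c d : eqm a b -> eqm c d -> eqm (z *: a + c) (z *: b + d).
Proof.
rewrite /eqm opprD addrACA -scalerBr => ab cd.
apply: (operated_idealD (Id_ideal _)) => //.
exact: (operated_idealZ (Id_ideal _)).
Qed.

Lemma eqmD a b c d : eqm a b -> eqm c d -> eqm (a + c) (b + d).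
Proof. by move=> ab cd; have := @eqmP 1 _ _ _ _ ab cd; rewrite 2!scale1r. Qed.

Lemma eqm_bracket om a b : eqm a b -> eqm (bracket om a) (bracket om b).
Proof.
rewrite /eqm => /(operated_idealP (Id_ideal _) om).
have -> // : bracket om (a - b) = bracket om a - bracket om b by exact: linearB.
Qed.

Lemma eqm_concat a b c d : eqm a b -> eqm c d -> eqm (concat a c) (concat b d).
Proof.
move=> ab cd; apply: (@eqm_trans _ (concat b c)).
  by rewrite /eqm -concatBl; exact: (operated_idealMr (Id_ideal _)).
have : Id RB (concat b (c - d)) by exact: (operated_idealMl (Id_ideal _)).
by have -> : concat b (c - d) = concat b c - concat b d by exact: linearB.
Qed.

Lemma RB_relation_Id (r : kM) : RB r -> Id RB r.
Proof. by move=> RBr I _; exact. Qed.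

Lemma RB_relation (x y : word) al be :
  eqm [w [:: Bracket al x; Bracket be y]]
    ([w [:: Bracket al (x ++ [:: Bracket be y])]]
     + [w [:: Bracket be (Bracket al x :: y)]]
     + lam be *: [w [:: Bracket al (x ++ y)]]).
Proof.
move=> I _; apply; exists x, y, al, be.
by rewrite 2!opprD 2!addrA.
Qed.

Lemma eqm_basis (T U : kM -> kM) : linear T -> linear U ->
  (forall v, eqm (T [w v]) (U [w v])) -> forall b, eqm (T b) (U b).
Proof.
move=> lT lU TU b; pattern b; apply: free_ind => // [z x y Kx Ky|].
  by rewrite lT lU; exact: eqmP.
by rewrite (linear_map0 lT) (linear_map0 lU); exact: eqm_refl.
Qed.

Lemma eqm_RB (a : kM) (y : word) al be :
  eqm (concat (bracket al a) [w [:: Bracket be y]])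
    (bracket al (concat a [w [:: Bracket be y]])
     + bracket be (concat (bracket al a) [w y])
     + lam be *: bracket al (concat a [w y])).
Proof.
move: a; apply: (eqm_basis (T := fun a => concat (bracket al a) _)
  (U := fun a => bracket al (concat a _) + bracket be (concat (bracket al a) _)
        + lam be *: bracket al (concat a _))) => [||x].
- by apply: linear_comp; [exact: concatPl | exact: bracketP].
- have lal v := linear_comp (bracketP al) (concatPl v).
  apply: linear_add; last by apply: linear_scale; exact: lal.
  apply: linear_add; first exact: lal.
  apply: linear_comp; first exact: bracketP.
  by apply: linear_comp; [exact: concatPl | exact: bracketP].
rewrite (bracket_basis _ al x) (concat_basis _ [:: _] [:: _]).
rewrite (concat_basis _ x [:: _]) (concat_basis _ [:: _] y).
rewrite (concat_basis _ x y) 3!bracket_basis; exact: RB_relation.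
Qed.

(** If T is left multiplication by s modulo the ideal, then P_om(T) is left
    multiplication by the bracket of s: the clauses of [rb_op] are instances of
    the Rota-Baxter relation. *)
Lemma rb_op_represents om s T : linear T ->
  (forall b, eqm (concat s b) (T b)) ->
  forall b, eqm (concat (bracket om s) b) (rb_op om T b).
Proof.
move=> lT sT; apply: eqm_basis => [||v].
- by move=> ? ? ?; exact: linearP.
- exact: rb_op_linear.
have sT1 : eqm (bracket om s) (bracket om (T [w [::]])).
  by apply: eqm_bracket; rewrite -{1}[s]concat1r; exact: sT.
elim/word_ind: v => [|x v _|be y v IHy _].
- by rewrite rb_op_nil concat1r.
- by rewrite rb_op_Var; apply: eqm_concat => //; exact: eqm_refl.
rewrite rb_op_Bracket.
have -> : [w Bracket be y :: v] = concat [w [:: Bracket be y]] [w v].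
  by symmetry; exact: concat_basis.
rewrite concatA; apply: eqm_concat; last exact: eqm_refl.
apply: eqm_trans (eqm_RB _ _ _ _) _.
apply: eqmD; last first.
  rewrite -[X in eqm X _]addr0 -[X in eqm _ X]addr0; apply: eqmP.
    by apply: eqm_bracket; exact: sT.
  exact: eqm_refl.
by apply: eqmD; apply: eqm_bracket; [exact: sT | exact: IHy].
Qed.

Lemma act_represents u b : eqm (concat [w u] b) (act lam u b).
Proof.
elim/word_ind: u b => [|x v IHv|om u v IHu IHv] b.
- by rewrite concat1l; exact: eqm_refl.
- rewrite -[[w Var x :: v]](concat_basis k [:: Var x] v) -concatA.
  by apply: eqm_concat; [exact: eqm_refl | exact: IHv].
rewrite -[[w _ :: v]](concat_basis k [:: Bracket om u] v) -concatA act_Bracket.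
rewrite -bracket_basis.
apply: eqm_trans (rb_op_represents _ _ IHu _); last exact: act_linear.
by apply: eqm_concat; [exact: eqm_refl | exact: IHv].
Qed.

Lemma eqm_rho a : eqm a (rho lam a [w [::]]).
Proof.
move: a; apply: (eqm_basis (T := id)) => [//|z x y|v].
  exact: rhoPl.
by rewrite rho_basis -{1}[[w v]]concat1r; exact: act_represents.
Qed.

(** The kernel of the representation is an operated ideal, because [rb_op om] is
    linear in the operator, and it contains the relations by [rb_opP]. *)
Lemma rho_Id (a b : kM) : Id RB a -> rho lam a b = 0.
Proof.
pose I : set kM := [set c | forall d, rho lam c d = 0]%classic.
have iI : is_operated_ideal I.
  split.
  - by move=> d; rewrite /rho linear0.
  - by move=> c d Ic Id e; rewrite -[c]scale1r rhoPl Ic Id scaler0 addr0.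
  - by move=> z c Ic e; rewrite -[z *: c]addr0 rhoPl Ic /rho !linear0 addr0.
  - move=> c d Id e; rewrite rho_concat Id.
    by rewrite (linear_map0 (rhoPr lam c)).
  - by move=> c d Ic e; rewrite rho_concat Ic.
  move=> om c Ic e; rewrite rho_bracket.
  have -> : rho lam c = fun d => (-1) *: rho lam c d + rho lam c d.
    by apply/funext => d; rewrite Ic scaler0 addr0.
  by rewrite rb_op_oplinear scaleN1r addNr.
move=> /(_ I iI); apply=> {a b iI} _ [x [y [al [be ->]]]] b.
have rhoB c d e : rho lam (c - d) e = rho lam c e - rho lam d e.
  exact: (linearB (linext (fun u => act lam u e))).
have rhoZ z c e : rho lam (z *: c) e = z *: rho lam c e.
  exact: (linearZ_LR (linext (fun u => act lam u e))).
rewrite 3!rhoB rhoZ !rho_basis.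
have -> : act lam [:: Bracket al x; Bracket be y] b =
    rb_op al (act lam x) (rb_op be (act lam y) b) by [].
have -> : act lam [:: Bracket al (x ++ [:: Bracket be y])] b =
    rb_op al (act lam x \o rb_op be (act lam y)) b.
  by rewrite act_Bracket act_cat.
have -> : act lam [:: Bracket be (Bracket al x :: y)] b =
    rb_op be (rb_op al (act lam x) \o act lam y) b by [].
have -> : act lam [:: Bracket al (x ++ y)] b =
    rb_op al (act lam x \o act lam y) b.
  by rewrite act_Bracket act_cat.
rewrite (rb_opP _ _ _ _ (act_linear lam x) (act_linear lam y)).
have subr3 (V : zmodType) (u v t : V) : u + v + t - u - v - t = 0.
  by rewrite -!addrA -!opprD !addrA subrr.
exact: subr3.
Qed.

(** The normal form of a is its action on the empty word. *)
Lemma phi_spec a : eqm a (Xincl (phi lam a)).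
Proof.
have [b eb] : nf_span (rho lam a [w [::]]).
  by apply: rho_span; exact: nf_span_basis.
have ab : Id RB (a - Xincl b) by rewrite -eb; exact: eqm_rho.
exact: (@xgetI _ 0 [set b | Id RB (a - Xincl b)]%classic b ab).
Qed.

(** Uniqueness of the normal form: acting on the empty word fixes the combinations
    of Rota-Baxter words and kills the ideal. *)
Lemma eqm_Xincl (b c : kXinf) : eqm (Xincl b) (Xincl c) -> b = c.
Proof.
move=> /(rho_Id [w [::]]); have -> : Xincl b - Xincl c = Xincl (b - c).
  by symmetry; exact: linearB.
rewrite rho_Xincl => bc; apply/eqP; rewrite -subr_eq0; apply/eqP.
by apply: Xincl_inj; rewrite bc; symmetry; exact: linear0.
Qed.

Lemma phi_eq (a b : kM) : eqm a b -> phi lam a = phi lam b.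
Proof.
move=> ab; apply: eqm_Xincl; apply: eqm_trans (phi_spec b).
by apply: eqm_trans ab; apply: eqm_sym; exact: phi_spec.
Qed.

Lemma phi_Xincl (b : kXinf) : phi lam (Xincl b) = b.
Proof. by apply: eqm_Xincl; apply: eqm_sym; exact: phi_spec. Qed.

Lemma phi_linear : linear (phi lam : kM -> kXinf).
Proof.
move=> z a b; apply: eqm_Xincl.
have -> : Xincl (z *: phi lam a + phi lam b) =
    z *: Xincl (phi lam a) + Xincl (phi lam b) by exact: linearP.
apply: eqm_trans (eqmP _ (phi_spec a) (phi_spec b)).
by apply: eqm_sym; exact: phi_spec.
Qed.

Lemma phi_concat (a b : kM) :
  phi lam (concat a b) = diamond_w lam (phi lam a) (phi lam b).
Proof. by apply: phi_eq; apply: eqm_concat; exact: phi_spec. Qed.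

End Reduction.

(** * Classes of forests *)

(** Locked because conversion would otherwise unfold [psi], down to the choice
    operator in [phi], whenever two classes are compared. *)
HB.lock Definition class (k : comPzRingType) (X Omega : Type) (lam : Omega -> k)
    (F : forest X Omega) : freeMod k (set_type (@Linf X Omega)) :=
  psi lam (basis k F).

Section ForestQuotient.
Variables (k : comPzRingType) (X Omega : Type) (lam : Omega -> k).
Notation word := (word X Omega).
Notation forest := (forest X Omega).
Notation kM := (freeMod k word).
Notation kXinf := (freeMod k (set_type (@Xinf X Omega))).
Notation H := (freeMod k (set_type (@Linf X Omega))).
Notation one := (basis k (@Linf_one X Omega)).
Notation diamond := (@diamond_l k X Omega lam).
Notation Bplus := (@Bplus k X Omega).

(** The map [psi] read on words, before the transport to forests. *)
Definition psi_word (a : kM) : H := theta_X (phi lam a).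

Lemma theta_X_linear : linear (@theta_X k X Omega : kXinf -> H).
Proof. by move=> z a b; exact: linearP. Qed.

Lemma theta_inv_X_linear : linear (@theta_inv_X k X Omega : H -> kXinf).
Proof. by move=> z a b; exact: linearP. Qed.

Lemma Xincl_linear : linear (@Xincl k X Omega).
Proof. by move=> z a b; exact: linearP. Qed.

Lemma psi_word_linear : linear psi_word.
Proof. exact: (linear_comp theta_X_linear (@phi_linear k X Omega lam)). Qed.

Lemma theta_inv_XK : cancel (@theta_inv_X k X Omega) (@theta_X k X Omega).
Proof.
move=> h; linear_ext_on h => [||F].
- exact: (linear_comp theta_X_linear theta_inv_X_linear).
- by [].
have -> : theta_inv_X (basis k F) = basis k (theta_inv_Xinf F).
  exact: linext_basis.
rewrite [LHS]linext_basis; congr (basis k _); apply: val_inj => /=.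
exact: (mapK (@theta_inv_treeK X Omega)).
Qed.

Lemma theta_XK : cancel (@theta_X k X Omega) (@theta_inv_X k X Omega).
Proof.
move=> h; linear_ext_on h => [||F].
- exact: (linear_comp theta_inv_X_linear theta_X_linear).
- by [].
have -> : theta_X (basis k F) = basis k (theta_Xinf F).
  exact: linext_basis.
rewrite [LHS]linext_basis; congr (basis k _); apply: val_inj => /=.
exact: theta_wordK.
Qed.

Lemma psi_word_concat a b :
  psi_word (concat a b) = diamond (psi_word a) (psi_word b).
Proof. by rewrite /psi_word /diamond_l 2!theta_XK phi_concat. Qed.

Lemma diamondPl b : linear (diamond^~ b).
Proof.
apply: (linear_comp (f := psi_word)
  (g := fun a => concat (Xincl (theta_inv_X a)) _)).
  exact: psi_word_linear.
apply: (linear_comp (f := (@concat k X Omega)^~ _)); first exact: concatPl.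
exact: (linear_comp Xincl_linear theta_inv_X_linear).
Qed.

Lemma diamondPr a : linear (diamond a).
Proof.
apply: (linear_comp (f := psi_word)
  (g := fun b => concat _ (Xincl (theta_inv_X b)))).
  exact: psi_word_linear.
apply: (linear_comp (f := concat _)); first exact: concatPr.
exact: (linear_comp Xincl_linear theta_inv_X_linear).
Qed.

Lemma Bplus_linear w : linear (Bplus w : H -> H).
Proof. by move=> z a b; exact: linearP. Qed.

Lemma psi_word_Xincl b : psi_word (Xincl b) = theta_X b.
Proof. by rewrite /psi_word phi_Xincl. Qed.

Lemma psi_word_eq a b : eqm lam a b -> psi_word a = psi_word b.
Proof. by move=> ab; rewrite /psi_word (phi_eq ab). Qed.

Lemma psi_word_bracket w a : psi_word (bracket w a) = Bplus w (psi_word a).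
Proof.
rewrite (psi_word_eq (eqm_bracket w (@phi_spec k X Omega lam a))) /psi_word.
move: (phi lam a) => b; linear_ext_on b => [||u].
- apply: (linear_comp psi_word_linear (g := fun b => bracket w (Xincl b))).
  exact: (linear_comp (bracketP w) Xincl_linear).
- exact: (linear_comp (@Bplus_linear w) theta_X_linear).
have -> : Xincl (basis k u) = basis k (val u) by exact: linext_basis.
have -> : theta_X (basis k u) = basis k (theta_Xinf u) by exact: linext_basis.
have -> : Bplus w (basis k (theta_Xinf u)) =
    basis k (graft_Linf w (theta_Xinf u)).
  exact: linext_basis.
pose v : set_type (@Xinf X Omega) :=
  SigSub (mem_set (Xinf_bracket w (set_mem (valP u)))).
rewrite bracket_basis.
have -> : basis k ([:: Bracket w (val u)] : word) = Xincl (basis k v).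
  by symmetry; exact: linext_basis.
rewrite phi_Xincl [LHS]linext_basis; congr (basis k _).
exact: val_inj.
Qed.

Notation class := (class lam).

Lemma classE F : class F = psi_word (basis k (theta_inv_forest F)).
Proof. by rewrite unlock /psi [theta_inv _]linext_basis. Qed.

Lemma class_cat F G : class (F ++ G) = diamond (class F) (class G).
Proof.
rewrite 3!classE -psi_word_concat concat_basis; congr (psi_word (basis k _)).
exact: map_cat.
Qed.

Lemma class_Node w F : class [:: Node w F] = Bplus w (class F).
Proof. by rewrite 2!classE -psi_word_bracket bracket_basis. Qed.

Lemma class_val (F : set_type (@Linf X Omega)) : class (val F) = basis k F.
Proof.
rewrite classE -[RHS]theta_inv_XK -psi_word_Xincl.
rewrite [theta_inv_X _]linext_basis; congr psi_word.
by symmetry; exact: linext_basis.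
Qed.

Lemma class_nil : class [::] = one.
Proof. by rewrite -class_val. Qed.

Lemma class_RB al be (F G : forest) :
  class [:: Node al F; Node be G] =
  class [:: Node al (F ++ [:: Node be G])]
  + class [:: Node be (Node al F :: G)] + lam be *: class [:: Node al (F ++ G)].
Proof.
rewrite 4!classE /= 2!map_cat.
rewrite (psi_word_eq (@RB_relation k X Omega lam _ _ al be)).
exact: (linear3 _ _ _ _ psi_word_linear).
Qed.

(** Reduces identities in the quotient to classes of arbitrary forests, which are
    closed under concatenation, as the forests in [Linf] are not. *)
Lemma class_ext (M : lmodType k) (f g : H -> M) :
  linear f -> linear g -> (forall F, f (class F) = g (class F)) -> f =1 g.
Proof.
by move=> lf lg fg; apply: linear_ext => // F; rewrite -class_val.
Qed.

Definition theta_basis (M : lmodType k) (f : forest -> M) (a : kM) : M :=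
  linext (fun u => f (theta_word u)) a.

(** A map on forests comes from the quotient when its linear extension kills
    the operated ideal. *)
Definition descends (M : lmodType k) (f : forest -> M) : Prop :=
  forall a, Id (RB_relations lam) a -> theta_basis f a = 0.

Definition induced (M : lmodType k) (f : forest -> M) : H -> M :=
  linext (fun F => f (val F)).

Lemma induced_class (M : lmodType k) (f : forest -> M) F :
  descends f -> induced f (class F) = f F.
Proof.
move=> f0; rewrite /induced; pose u := theta_inv_forest F.
have E b : linext (fun G => f (val G)) (theta_X b) = theta_basis f (Xincl b).
  linear_ext_on b => [||v].
  - apply: (linear_comp (f := linext _)); last exact: theta_X_linear.
    by move=> ? ? ?; exact: linearP.
  - apply: (linear_comp (f := theta_basis f)); last exact: Xincl_linear.
    by move=> ? ? ?; exact: linearP.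
  have -> : theta_X (basis k v) = basis k (theta_Xinf v) by exact: linext_basis.
  have -> : Xincl (basis k v) = basis k (val v) by exact: linext_basis.
  by rewrite [LHS]linext_basis [RHS]linext_basis.
rewrite classE E -/u; symmetry.
have -> : f F = theta_basis f (basis k u).
  rewrite [RHS]linext_basis; congr f; symmetry.
  exact: (mapK (@theta_inv_treeK X Omega)).
apply/eqP; rewrite -subr_eq0; apply/eqP.
rewrite -(f0 _ (@phi_spec k X Omega lam (basis k u))).
by symmetry; exact: linearB.
Qed.

End ForestQuotient.

(** * Lower sets of addresses *)

Section LowerSets.
Local Open Scope fset_scope.

(** The subforests of F are the lower sets of its set of vertices. *)
Definition lower (V : {fset address}) : {fset {fset address}} :=
  [fset G in fpowerset V |
    `[< forall a b, a \in G -> b \in V -> prefix a b -> b \in G >]].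

Lemma lowerP V G :
  reflect (G `<=` V /\ forall a b, a \in G -> b \in V -> prefix a b -> b \in G)
    (G \in lower V).
Proof.
rewrite !inE /= fpowersetE.
by apply: (iffP andP) => -[GV /asboolP cl].
Qed.

Lemma lower_fset0 : lower fset0 = [fset fset0].
Proof.
apply/fsetP => G; rewrite !inE fpowerset0 !inE; case: eqP => //= ->.
by apply/asboolP.
Qed.

(** A lower set that contains the root is everything; this is the cocycle
    condition for the coproduct. *)
Lemma lower_root (V : {fset address}) : [::] \notin V ->
  perm_eq (lower ([::] |` V)) ([::] |` V :: lower V).
Proof.
move=> rV; apply: uniq_perm => [|/=|G]; first exact: fset_uniq.
  rewrite fset_uniq andbT; apply/negP => /lowerP [/fsubsetP/(_ [::])].
  by rewrite fset1U1 (negPf rV) => /(_ isT).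
rewrite in_cons; apply/lowerP/orP => [[GV cl]|[/eqP->|/lowerP [GV cl]]].
- have [rG|rG] := boolP ([::] \in G); [left|right].
    rewrite eqEfsubset GV; apply/fsubsetP => a aV.
    by apply: (cl [::]); rewrite ?prefix0s.
  apply/lowerP; split=> [|a b aG bV]; last by apply: cl; rewrite // !inE bV orbT.
  apply/fsubsetP => a aG; have /fsubsetP/(_ _ aG) := GV.
  by rewrite !inE => /orP [/eqP a0|//]; move: rG; rewrite -a0 aG.
- by split=> [|a b _ bV _]; [exact: fsubset_refl|].
split=> [|a b aG]; first exact: fsubset_trans GV (fsubsetU1 _ _).
rewrite !inE => /orP [/eqP ->|bV]; last exact: cl.
by rewrite prefixs0 => /eqP a0; move: rV; rewrite -a0 (fsubsetP GV).
Qed.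

Definition shift (n : nat) (G : {fset address}) : {fset address} :=
  [fset n :: a | a in G].

Lemma mem_shift n G a : (n :: a \in shift n G) = (a \in G).
Proof. by rewrite mem_imfset // => x y []. Qed.

Lemma lower_shift n (V : {fset address}) :
  perm_eq (lower (shift n V)) (map (shift n) (lower V)).
Proof.
apply: uniq_perm => [||G]; first exact: fset_uniq.
  rewrite map_inj_uniq ?fset_uniq // => G1 G2 /fsetP G12; apply/fsetP => a.
  by rewrite -(mem_shift n G1) G12 mem_shift.
apply/lowerP/mapP => [[GV cl]|[G' /lowerP [GV cl] ->]].
  exists [fset a in V | n :: a \in G].
    apply/lowerP; split=> [|a b]; first exact: fset_sub.
    rewrite !inE => /andP [_ aG] bV ab; rewrite bV /=; apply: (cl (n :: a)) => //.
      by rewrite mem_shift.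
    by rewrite prefix_cons eqxx.
  apply/fsetP => b; apply/idP/imfsetP => [bG|[a /=]].
    have /imfsetP [a /= aV eb] := fsubsetP GV _ bG.
    by exists a => //=; rewrite !inE aV -eb.
  by rewrite !inE => /andP [_ aG] ->.
split=> [|a b /imfsetP [a' /= a'G ->] /imfsetP [b' /= b'V ->]].
  by apply/fsubsetP => b /imfsetP [a /= aG ->]; rewrite mem_shift (fsubsetP GV).
by rewrite prefix_cons eqxx mem_shift; exact: cl.
Qed.

(** A lower set of a disjoint union without edges across is a pair of lower sets;
    this is the multiplicativity of the coproduct. *)
Lemma lowerU (V1 V2 : {fset address}) :
  (forall a b, a \in V1 -> b \in V2 -> ~~ prefix a b && ~~ prefix b a) ->
  perm_eq (lower (V1 `|` V2)) [seq G1 `|` G2 | G1 <- lower V1, G2 <- lower V2].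
Proof.
move=> V12; have dis a : a \in V1 -> a \in V2 -> False.
  by move=> a1 a2; have := V12 _ _ a1 a2; rewrite prefix_refl.
have cap G1 G2 : G1 `<=` V1 -> G2 `<=` V2 ->
    ((G1 `|` G2) `&` V1 = G1) * ((G1 `|` G2) `&` V2 = G2).
  move=> /fsubsetP G1V /fsubsetP G2V; split; apply/fsetP => a; rewrite !inE.
    have [/G1V ->//|_ /=] := boolP (a \in G1).
    by apply/negP => /andP [/G2V a2 a1]; exact: (dis a).
  rewrite orbC; have [/G2V ->//|_ /=] := boolP (a \in G2).
  by apply/negP => /andP [/G1V a1 a2]; exact: (dis a).
apply: uniq_perm => [||G]; first exact: fset_uniq.
  apply: allpairs_uniq; [exact: fset_uniq|exact: fset_uniq|].
  move=> x y /allpairsP [[G1 G2] /= [/lowerP [G1V _] /lowerP [G2V _] ->]].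
  move=> /allpairsP [[G1' G2'] /= [/lowerP [G1V' _] /lowerP [G2V' _] ->]] /= eG.
  congr (_, _); first by rewrite -(cap _ _ G1V G2V).1 eG (cap _ _ G1V' G2V').1.
  by rewrite -(cap _ _ G1V G2V).2 eG (cap _ _ G1V' G2V').2.
apply/lowerP/allpairsP =>
    [[GV cl]|[[G1 G2] /= [/lowerP [G1V cl1] /lowerP [G2V cl2] ->]]].
  exists (G `&` V1, G `&` V2) => /=; split.
  - apply/lowerP; split=> [|a b]; first exact: fsubsetIr.
    by rewrite !inE => /andP [aG _] bV ab; rewrite bV andbT (cl a) // !inE bV.
  - apply/lowerP; split=> [|a b]; first exact: fsubsetIr.
    by rewrite !inE => /andP [aG _] bV ab; rewrite bV andbT (cl a) // !inE bV orbT.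
  by rewrite -fsetIUr; symmetry; apply/fsetIidPl.
split=> [|a b]; first exact: fsetUSS.
rewrite !inE => /orP [aG|aG] /orP [bV|bV] ab.
- by rewrite (cl1 a).
- by have := V12 _ _ (fsubsetP G1V _ aG) bV; rewrite ab.
- by have := V12 _ _ bV (fsubsetP G2V _ aG); rewrite ab andbF.
- by rewrite (cl2 a) // orbT.
Qed.

End LowerSets.

(** * Cuts of forests *)

Section Cuts.
Variables X Omega : Type.
Notation tree := (tree X Omega).
Notation forest := (forest X Omega).

Lemma forest_ind (K : forest -> Prop) :
  K [::] -> (forall x F, K F -> K (Leaf x :: F)) ->
  (forall w G F, K G -> K F -> K (Node w G :: F)) -> forall F, K F.
Proof.
move=> K0 Kx Kb.
suff Kl : forall t F, K F -> K (t :: F) by elim=> // t F; exact: Kl.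
fix IHt 1 => -[x|w G] F KF; first exact: Kx.
apply: Kb => //; elim: G => [|t G IHG]; first exact: K0.
exact: IHt.
Qed.

Definition cut_cons (s s' : seq (forest * forest)) : seq (forest * forest) :=
  [seq (p.1 ++ q.1, p.2 ++ q.2) | p <- s, q <- s'].

(** The pairs (subforest, remainder), listed by recursion: the root of a tree
    belongs to the subforest only if the whole tree does, and otherwise it carries
    what remains of the forest below it. *)
Fixpoint cuts_tree (t : tree) : seq (forest * forest) :=
  match t with
  | Leaf x => [:: ([:: Leaf x], [::]); ([::], [:: Leaf x])]
  | Node w F =>
      ([:: Node w F], [::])
      :: [seq (p.1, [:: Node w p.2]) |
           p <- foldr (fun t => cut_cons (cuts_tree t)) [:: ([::], [::])] F]
  end.

Definition cuts (F : forest) : seq (forest * forest) :=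
  foldr (fun t => cut_cons (cuts_tree t)) [:: ([::], [::])] F.

Arguments cuts : simpl never.

Lemma cuts_treeE w F : cuts_tree (Node w F) =
  ([:: Node w F], [::]) :: [seq (p.1, [:: Node w p.2]) | p <- cuts F].
Proof. by []. Qed.

Section CutSums.
Variable V : nmodType.
Implicit Types f : forest * forest -> V.

Lemma sum_cuts_nil f : \sum_(p <- cuts [::]) f p = f ([::], [::]).
Proof. by rewrite big_seq1. Qed.

Lemma sum_cuts_cons t F f :
  \sum_(p <- cuts (t :: F)) f p =
  \sum_(p <- cuts_tree t) \sum_(q <- cuts F) f (p.1 ++ q.1, p.2 ++ q.2).
Proof. exact: big_allpairs_dep. Qed.

Lemma sum_cuts_tree t f : \sum_(p <- cuts [:: t]) f p = \sum_(p <- cuts_tree t) f p.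
Proof.
rewrite sum_cuts_cons; apply: eq_bigr => -[p1 p2] _.
by rewrite sum_cuts_nil /= !cats0.
Qed.

Lemma sum_cuts_Leaf x f :
  \sum_(p <- cuts [:: Leaf x]) f p = f ([:: Leaf x], [::]) + f ([::], [:: Leaf x]).
Proof. by rewrite sum_cuts_tree !big_cons big_nil addr0. Qed.

Lemma sum_cuts_Node w F f :
  \sum_(p <- cuts [:: Node w F]) f p =
  f ([:: Node w F], [::]) + \sum_(p <- cuts F) f (p.1, [:: Node w p.2]).
Proof. by rewrite sum_cuts_tree cuts_treeE big_cons big_map. Qed.

Lemma sum_cuts_cat F G f :
  \sum_(p <- cuts (F ++ G)) f p =
  \sum_(p <- cuts F) \sum_(q <- cuts G) f (p.1 ++ q.1, p.2 ++ q.2).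
Proof.
elim: F f => [|t F IHF] f.
  by rewrite sum_cuts_nil; apply: eq_bigr => -[].
rewrite sum_cuts_cons [RHS]sum_cuts_cons; apply: eq_bigr => p _.
rewrite IHF; apply: eq_bigr => q _; apply: eq_bigr => r _ /=.
by rewrite !catA.
Qed.

End CutSums.

(** The forests for which this holds are closed under concatenation, by
    [sum_cuts_cat] and an exchange of summations, and under grafting, by
    [sum_cuts_Node]. *)
Lemma sum_cuts_coassoc (V : nmodType) F (f : forest -> forest -> forest -> V) :
  \sum_(p <- cuts F) \sum_(q <- cuts p.1) f q.1 q.2 p.2 =
  \sum_(p <- cuts F) \sum_(q <- cuts p.2) f p.1 q.1 q.2.
Proof.
pose K F := forall f : forest -> forest -> forest -> V,
  \sum_(p <- cuts F) \sum_(q <- cuts p.1) f q.1 q.2 p.2 =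
  \sum_(p <- cuts F) \sum_(q <- cuts p.2) f p.1 q.1 q.2.
have Kcat F1 F2 : K F1 -> K F2 -> K (F1 ++ F2).
  move=> K1 K2 {}f; rewrite 2!sum_cuts_cat.
  transitivity (\sum_(p <- cuts F1) \sum_(q <- cuts p.1)
      \sum_(p' <- cuts F2) \sum_(q' <- cuts p'.1)
        f (q.1 ++ q'.1) (q.2 ++ q'.2) (p.2 ++ p'.2)).
    apply: eq_bigr => p _; rewrite exchange_big /=; apply: eq_bigr => p' _.
    exact: sum_cuts_cat.
  transitivity (\sum_(p <- cuts F1) \sum_(q <- cuts p.2)
      \sum_(p' <- cuts F2) \sum_(q' <- cuts p'.2)
        f (p.1 ++ p'.1) (q.1 ++ q'.1) (q.2 ++ q'.2)).
    rewrite (K1 (fun a b c => \sum_(p' <- cuts F2) \sum_(q' <- cuts p'.1)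
      f (a ++ q'.1) (b ++ q'.2) (c ++ p'.2))).
    apply: eq_bigr => p _; apply: eq_bigr => q _.
    exact: (K2 (fun a b c => f (p.1 ++ a) (q.1 ++ b) (q.2 ++ c))).
  apply: eq_bigr => p _; rewrite exchange_big /=; apply: eq_bigr => p' _.
  by symmetry; exact: sum_cuts_cat.
suff : K F by apply.
elim/forest_ind: F {f} => [|x F IHF|w G F IHG IHF].
- by move=> f; rewrite 2!sum_cuts_nil /= !sum_cuts_nil.
- rewrite -cat1s; apply: Kcat => // f.
  by rewrite 2!sum_cuts_Leaf /= sum_cuts_nil 2!sum_cuts_Leaf sum_cuts_nil /= addrA.
rewrite -cat1s; apply: Kcat => // f.
rewrite 2!sum_cuts_Node /= sum_cuts_Node sum_cuts_nil /= -addrA; congr (_ + _).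
under [in RHS]eq_bigr do rewrite sum_cuts_Node /=.
rewrite big_split /=; congr (_ + _).
exact: (IHG (fun a b c => f a b [:: Node w c])).
Qed.

Lemma sum_cuts_counitl (V : nmodType) F (f : forest -> V) :
  \sum_(p <- cuts F) f p.2 *+ nilp p.1 = f F.
Proof.
elim/forest_ind: F f => [|x F IHF|w G F IHG IHF] f.
- by rewrite sum_cuts_nil.
- rewrite -cat1s sum_cuts_cat sum_cuts_Leaf /= big1 ?add0r //.
  exact: (IHF (fun F => f (Leaf x :: F))).
rewrite -cat1s sum_cuts_cat sum_cuts_Node /= big1 ?add0r //.
rewrite -(IHG (fun G => f (Node w G :: F))); apply: eq_bigr => p _.
rewrite -(IHF (fun F => f (Node w p.2 :: F))) -sumrMnl; apply: eq_bigr => q _.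
by case: p.1 => [|? ?]; rewrite ?mulr1n ?mulr0n.
Qed.

Lemma sum_cuts_counitr (V : nmodType) F (f : forest -> V) :
  \sum_(p <- cuts F) f p.1 *+ nilp p.2 = f F.
Proof.
elim/forest_ind: F f => [|x F IHF|w G F IHG IHF] f.
- by rewrite sum_cuts_nil.
- rewrite -cat1s sum_cuts_cat sum_cuts_Leaf /= addrC big1 ?add0r //.
  exact: (IHF (fun F => f (Leaf x :: F))).
rewrite -cat1s sum_cuts_cat sum_cuts_Node /= addrC big1 ?add0r //.
  exact: (IHF (fun F => f (Node w G :: F))).
by move=> p _; rewrite big1.
Qed.

End Cuts.
Arguments cuts : simpl never.

(** * Subforests as cuts *)

Section SubforestsAsCuts.
Variables X Omega : Type.
Notation tree := (tree X Omega).
Notation forest := (forest X Omega).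
Local Open Scope fset_scope.

(** Addresses are shifted by a parameter n, so that the tail of a forest keeps the
    positions that it has in the forest. *)
Definition root_addresses (n : nat) (F : forest) : seq address :=
  iflat (fun i s => map (cons i) (tree_vertices s)) n F.

Definition restrict_from (n : nat) (F : forest) (D : pred address) : forest :=
  iflat (fun i s => restrict_tree s (fun a => D (i :: a))) n F.

Notation tverts t := [fset a in tree_vertices t].
Notation fverts n F := [fset a in root_addresses n F].

Lemma root_addresses_head n F a :
  a \in root_addresses n F -> exists i b, a = i :: b /\ (n <= i)%N.
Proof.
elim: F n => [//|t F IHF] n; rewrite /= mem_cat => /orP [/mapP [b _ ->]|].
  by exists n, b.
by move=> /IHF [i [b [-> /ltnW ni]]]; exists i, b.
Qed.

Lemma eq_restrict_from n (F : forest) (D D' : pred address) :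
  (forall a, a \in root_addresses n F -> D a = D' a) ->
  restrict_from n F D = restrict_from n F D'.
Proof.
elim/forest_ind: F n D D' => [//|x F IHF|w G F IHG IHF] n D D' DD'.
  congr (_ ++ _); last by apply: IHF => a aF; apply: DD'; rewrite mem_cat aF orbT.
  by rewrite /= DD' // mem_cat mem_head.
have DG : restrict_from 0 G (fun a => D (n :: a)) =
    restrict_from 0 G (fun a => D' (n :: a)).
  apply: IHG => a aG; apply: DD'; rewrite mem_cat; apply/orP; left.
  by apply: map_f; rewrite in_cons; apply/orP; right.
congr (_ ++ _); last by apply: IHF => a aF; apply: DD'; rewrite mem_cat aF orbT.
rewrite /= -/(restrict_from 0 G (fun a => D (n :: a))) DG.
by rewrite DD' // mem_cat mem_head.
Qed.

Lemma eq_restrict_tree (t : tree) (D D' : pred address) :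
  (forall a, a \in tree_vertices t -> D a = D' a) ->
  restrict_tree t D = restrict_tree t D'.
Proof.
move=> DD'; have := @eq_restrict_from 0 [:: t]
  (fun a => D (behead a)) (fun a => D' (behead a)).
rewrite /restrict_from /= !cats0; apply=> a.
by rewrite /root_addresses => /mapP [b bt ->]; exact: DD'.
Qed.

Lemma restrict_from_all n F : restrict_from n F predT = F.
Proof.
elim/forest_ind: F n => [//|x F IHF|w G F IHG IHF] n.
  exact: (congr1 (cons (Leaf x)) (IHF n.+1)).
exact: (congr2 (fun G F => Node w G :: F) (IHG 0%N) (IHF n.+1)).
Qed.

Lemma restrict_from_none n F : restrict_from n F pred0 = [::].
Proof.
elim/forest_ind: F n => [//|x F IHF|w G F IHG IHF] n; first exact: IHF.
exact: (congr2 cat (IHG 0%N) (IHF n.+1)).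
Qed.

Definition cut_of_tree t (G : {fset address}) : forest * forest :=
  (restrict_tree t [pred a | a \in G], restrict_tree t [pred a | a \notin G]).

Definition cut_of n F (G : {fset address}) : forest * forest :=
  (restrict_from n F [pred a | a \in G], restrict_from n F [pred a | a \notin G]).

(** Both sides obey the same recursion, on the left by [lowerU] and [lower_root].
    Trees and forests are treated together, as each occurs inside the other. *)
Lemma sum_lower (V : nmodType) :
  (forall t (f : forest * forest -> V),
     \sum_(G <- lower (tverts t)) f (cut_of_tree t G) =
     \sum_(p <- cuts_tree t) f p) *
  (forall n F (f : forest * forest -> V),
     \sum_(G <- lower (fverts n F)) f (cut_of n F G) = \sum_(p <- cuts F) f p).
Proof.
have Hnil n (f : forest * forest -> V) :
    \sum_(G <- lower (fverts n [::])) f (cut_of n [::] G) =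
    \sum_(p <- cuts [::]) f p.
  rewrite sum_cuts_nil.
  have -> : fverts n [::] = fset0 by apply/fsetP => a; rewrite !inE.
  by rewrite lower_fset0 big_seq_fset1.
have Hcons n t F (f : forest * forest -> V) :
    (forall g : forest * forest -> V,
       \sum_(G <- lower (tverts t)) g (cut_of_tree t G) =
       \sum_(p <- cuts_tree t) g p) ->
    (forall m (g : forest * forest -> V),
       \sum_(G <- lower (fverts m F)) g (cut_of m F G) = \sum_(p <- cuts F) g p) ->
    \sum_(G <- lower (fverts n (t :: F))) f (cut_of n (t :: F) G) =
    \sum_(p <- cuts (t :: F)) f p.
  move=> Ht HF; have -> : fverts n (t :: F) = shift n (tverts t) `|` fverts n.+1 F.
    apply/fsetP => a; rewrite !inE; congr (_ || _).
    apply/mapP/imfsetP => -[b /= bt ->]; exists b => //;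
      by move: bt; rewrite !inE.
  rewrite (perm_big _ (lowerU _)) /=; last first.
    move=> a b /imfsetP [a' _ ->].
    rewrite !inE => /root_addresses_head [i [b' [-> ni]]].
    by rewrite !prefix_cons [i == n]eq_sym (ltn_eqF ni).
  rewrite big_allpairs_dep sum_cuts_cons (perm_big _ (lower_shift n _)) big_map.
  rewrite -Ht big_seq [RHS]big_seq; apply: eq_bigr => G1 _.
  rewrite -(HF n.+1) big_seq [RHS]big_seq.
  apply: eq_bigr => G2 /lowerP [/fsubsetP G2V _].
  have tE a : (n :: a \in shift n G1 `|` G2) = (a \in G1).
    rewrite in_fsetU mem_shift orbC; case: (boolP (n :: a \in G2)) => //= /G2V.
    by rewrite !inE => /root_addresses_head [i [b [[-> _]]]]; rewrite ltnn.
  have FE a : a \in root_addresses n.+1 F -> (a \in shift n G1 `|` G2) = (a \in G2).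
    move=> /root_addresses_head [i [b [-> ni]]]; rewrite in_fsetU orbC.
    case: (i :: b \in G2) => //=; apply/negP => /imfsetP [c _ [ein _]].
    by rewrite ein ltnn in ni.
  congr (f (_, _)); congr (_ ++ _) => /=.
  - by apply: eq_restrict_tree => a _; exact: tE.
  - exact: (eq_restrict_from (D := [pred a | a \in _]) (D' := [pred a | a \in G2]) FE).
  - by apply: eq_restrict_tree => a _; rewrite /= tE.
  - exact: (eq_restrict_from (D := [pred a | a \notin _])
      (D' := [pred a | a \notin G2]) (fun a aF => congr1 negb (FE a aF))).
have HLeaf x (f : forest * forest -> V) :
    \sum_(G <- lower (tverts (Leaf x : tree))) f (cut_of_tree (Leaf x) G) =
    \sum_(p <- cuts_tree (Leaf x)) f p.
  have -> : tverts (Leaf x : tree) = [::] |` fset0.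
    by apply/fsetP => a; rewrite !inE orbF.
  rewrite (perm_big _ (lower_root _)) ?inE // big_cons lower_fset0 big_seq_fset1.
  rewrite /= big_cons big_seq1; congr (f _ + f _)%R; rewrite /cut_of_tree /=.
    by rewrite ?inE ?eqxx.
have HNode w F (f : forest * forest -> V) :
    (forall m (g : forest * forest -> V),
       \sum_(G <- lower (fverts m F)) g (cut_of m F G) = \sum_(p <- cuts F) g p) ->
    \sum_(G <- lower (tverts (Node w F))) f (cut_of_tree (Node w F) G) =
    \sum_(p <- cuts_tree (Node w F)) f p.
  move=> HF; have -> : tverts (Node w F) = [::] |` fverts 0 F.
    by apply/fsetP => a; rewrite !inE.
  have r0 : [::] \notin fverts 0 F.
    by apply/negP; rewrite !inE => /root_addresses_head [i [b []]].
  have aV a : a \in root_addresses 0 F -> a \in [::] |` fverts 0 F.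
    by move=> aF; rewrite !inE; apply/orP; right.
  rewrite (perm_big _ (lower_root r0)) big_cons cuts_treeE big_cons big_map.
  rewrite -(HF 0%N); congr (f (_, _) + _)%R.
  - rewrite /= -/(restrict_from 0 F _) !inE /=; congr [:: Node w _].
    rewrite -[RHS](restrict_from_all 0); apply: eq_restrict_from => a aF.
    exact: aV.
  - rewrite /= -/(restrict_from 0 F _) ?inE /=.
    rewrite -[RHS](restrict_from_none 0 F).
    apply: (eq_restrict_from (D := [pred a | a \notin _])) => a aF.
    exact: (congr1 negb (aV a aF)).
  rewrite big_seq [RHS]big_seq; apply: eq_bigr => G /lowerP [/fsubsetP GV _].
  have rG : [::] \notin G by apply: contra r0 => /GV.
  by rewrite /cut_of_tree /= (negPf rG).
have HF F : forall n (f : forest * forest -> V),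
    \sum_(G <- lower (fverts n F)) f (cut_of n F G) = \sum_(p <- cuts F) f p.
  elim/forest_ind: F => [|x F IHF|w G F IHG IHF] n f; first exact: Hnil.
    by apply: Hcons => // g; exact: HLeaf.
  by apply: Hcons => // g; exact: HNode.
by split=> [[x|w F]|n F] f; [exact: HLeaf|exact: HNode|exact: HF].
Qed.

End SubforestsAsCuts.

Lemma Delta_RT_basis (k : comPzRingType) (X Omega : Type) (F : forest X Omega) :
  Delta_RT (basis k F) = \sum_(p <- cuts F) basis k p.
Proof.
rewrite [LHS]linext_basis.
have := (@sum_lower X Omega (freeMod k (forest X Omega * forest X Omega)%type)).2.
by move=> /(_ 0%N F (fun p => basis k p)).
Qed.

(** * Convolution of maps on forests *)

Section Weight.
Variables X Omega : Type.
Notation tree := (tree X Omega).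
Notation forest := (forest X Omega).

Fixpoint weight_tree (t : tree) : nat :=
  if t is Node _ F then (sumn (map weight_tree F)).+1 else 1.

Definition weight (F : forest) : nat := sumn (map weight_tree F).

Lemma weight_cat F G : weight (F ++ G) = (weight F + weight G)%N.
Proof. by rewrite /weight map_cat sumn_cat. Qed.

Lemma weight_Node w F : weight [:: Node w F] = (weight F).+1.
Proof. exact: addn0. Qed.

Lemma weight_gt0 F : ~~ nilp F -> (0 < weight F)%N.
Proof. by case: F => [|[x|w G] F]. Qed.

(** Cutting loses no vertex, so that the coproduct is graded. *)
Lemma weight_cuts F p : p \in cuts F -> (weight p.1 + weight p.2)%N = weight F.
Proof.
have Kcons t G q : (forall p, p \in cuts_tree t ->
      (weight p.1 + weight p.2)%N = weight [:: t]) ->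
    (forall p, p \in cuts G -> (weight p.1 + weight p.2)%N = weight G) ->
    q \in cuts (t :: G) -> (weight q.1 + weight q.2)%N = weight (t :: G).
  move=> Kt KG /allpairsP [[r s] /= [/Kt Kr /KG Ks ->]] /=.
  by rewrite !weight_cat addnACA Kr Ks -weight_cat.
elim/forest_ind: F p => [|x F IHF|w G F IHG IHF] p.
- by rewrite inE => /eqP ->.
- by apply: Kcons => // q; rewrite !inE => /orP [] /eqP ->.
apply: Kcons => // q; rewrite cuts_treeE in_cons => /orP [/eqP ->|/mapP [r rG ->]].
  by rewrite addn0.
by rewrite [_.1]/= [_.2]/= !weight_Node addnS IHG.
Qed.

End Weight.

Section Convolution.
Variables (k : comPzRingType) (X Omega : Type) (V : lmodType k).
Variables (mul : V -> V -> V) (one : V).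
Hypotheses (mulPl : forall b, linear (mul^~ b)) (mulPr : forall a, linear (mul a)).
Hypotheses (mulA : associative mul).
Hypotheses (mul1 : left_id one mul) (mulr1 : right_id one mul).
Notation forest := (forest X Omega).
Implicit Types u v : forest -> V.

Definition conv u v (F : forest) : V := \sum_(p <- cuts F) mul (u p.1) (v p.2).

Definition conv_unit (F : forest) : V := one *+ nilp F.

Let mul_suml (I : Type) (r : seq I) (f : I -> V) b :
  mul (\sum_(i <- r) f i) b = \sum_(i <- r) mul (f i) b.
Proof. exact: (linear_map_sum _ _ (mulPl b)). Qed.

Let mul_sumr (I : Type) (r : seq I) (f : I -> V) a :
  mul a (\sum_(i <- r) f i) = \sum_(i <- r) mul a (f i).
Proof. exact: (linear_map_sum _ _ (mulPr a)). Qed.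

Lemma convA u v t F : conv (conv u v) t F = conv u (conv v t) F.
Proof.
transitivity (\sum_(p <- cuts F) \sum_(q <- cuts p.1)
    mul (mul (u q.1) (v q.2)) (t p.2)).
  by apply: eq_bigr => p _; exact: mul_suml.
rewrite (sum_cuts_coassoc F (fun a b c => mul (mul (u a) (v b)) (t c))).
apply: eq_bigr => p _; rewrite mul_sumr.
by apply: eq_bigr => q _; rewrite mulA.
Qed.

Let mul0l a : mul 0 a = 0. Proof. exact: (linear_map0 (mulPl a)). Qed.
Let mul0r a : mul a 0 = 0. Proof. exact: (linear_map0 (mulPr a)). Qed.

Lemma conv1l u F : conv conv_unit u F = u F.
Proof.
rewrite -[RHS]sum_cuts_counitl; apply: eq_bigr => p _; rewrite /conv_unit.
by case: nilp; rewrite ?mulr1n ?mulr0n ?mul1 ?mul0l.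
Qed.

Lemma conv1r u F : conv u conv_unit F = u F.
Proof.
rewrite -[RHS]sum_cuts_counitr; apply: eq_bigr => p _; rewrite /conv_unit.
by case: nilp; rewrite ?mulr1n ?mulr0n ?mulr1 ?mul0r.
Qed.

Fixpoint conv_pow u n : forest -> V :=
  if n is n'.+1 then conv (conv_pow u n') u else conv_unit.

(** The powers are defined by multiplication on the right; the geometric series is
    a two-sided inverse because multiplication on the left gives the same. *)
Lemma conv_powC u n F : conv u (conv_pow u n) F = conv_pow u n.+1 F.
Proof.
elim: n F => [|n IHn] F; first by rewrite /= conv1r conv1l.
rewrite /= -convA; apply: eq_bigr => p _; congr mul; exact: IHn.
Qed.

(** Every factor that contributes to the power takes at least one vertex. *)
Lemma conv_pow0 u n F : u [::] = 0 -> (weight F < n)%N -> conv_pow u n F = 0.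
Proof.
move=> u0; elim: n F => [//|n IHn] F; rewrite ltnS => wF /=.
rewrite /conv big_seq big1 // => p /weight_cuts wp.
have [/nilP ->|/weight_gt0 p2] := boolP (nilp p.2); first by rewrite u0 mul0r.
rewrite IHn ?mul0l // (leq_trans _ wF) // -wp.
by rewrite -[X in (X < _)%N]addn0 ltn_add2l.
Qed.

(** The geometric series of e - u, where e is the unit [conv_unit]; the terms of
    index greater than the weight vanish by [conv_pow0]. *)
Definition conv_inv u (F : forest) : V :=
  \sum_(n < (weight F).+1) conv_pow (fun G => conv_unit G - u G) n F.

Section Inverse.
Variables (u : forest -> V).
Hypothesis u1 : u [::] = one.
Let j G := conv_unit G - u G.

Lemma j0 : j [::] = 0. Proof. by rewrite /j /conv_unit u1 mulr1n subrr. Qed.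

Lemma conv_inv_stable F N : (weight F < N)%N ->
  conv_inv u F = \sum_(n < N) conv_pow j n F.
Proof.
move=> wN; rewrite /conv_inv (big_ord_widen N (fun n => conv_pow j n F) wN).
rewrite [RHS](bigID (fun n : 'I_N => (n < (weight F).+1)%N)) /=.
rewrite [X in _ = _ + X]big1 ?addr0 // => n; rewrite -leqNgt => wn.
exact: conv_pow0 j0 wn.
Qed.

Lemma telescope_conv_pow N F :
  \sum_(n < N) (conv_pow j n F - conv_pow j n.+1 F) =
  conv_unit F - conv_pow j N F.
Proof.
elim: N => [|N IHN]; first by rewrite big_ord0 subrr.
by rewrite big_ord_recr /= IHN subrKA.
Qed.

Lemma uE G : u G = conv_unit G - j G.
Proof. by rewrite /j opprB addrC subrK. Qed.

Lemma conv_invl F : conv (conv_inv u) u F = conv_unit F.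
Proof.
transitivity (\sum_(n < (weight F).+1) conv (conv_pow j n) u F).
  rewrite exchange_big /= /conv big_seq [RHS]big_seq; apply: eq_bigr => p pF.
  rewrite (@conv_inv_stable _ (weight F).+1) ?mul_suml //.
  by rewrite ltnS -(weight_cuts pF) leq_addr.
transitivity (\sum_(n < (weight F).+1) (conv_pow j n F - conv_pow j n.+1 F)).
  apply: eq_bigr => n _; rewrite -[X in X - _]conv1r -sumrB.
  apply: eq_bigr => p _; rewrite uE -scaleN1r addrC mulPr scaleN1r addrC.
  by [].
by rewrite telescope_conv_pow conv_pow0 ?subr0 // j0.
Qed.

Lemma conv_invr F : conv u (conv_inv u) F = conv_unit F.
Proof.
transitivity (\sum_(n < (weight F).+1) conv u (conv_pow j n) F).
  rewrite exchange_big /= /conv big_seq [RHS]big_seq; apply: eq_bigr => p pF.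
  rewrite (@conv_inv_stable _ (weight F).+1) ?mul_sumr //.
  by rewrite ltnS -(weight_cuts pF) leq_addl.
transitivity (\sum_(n < (weight F).+1) (conv_pow j n F - conv_pow j n.+1 F)).
  apply: eq_bigr => n _; rewrite -[X in X - _]conv1l -conv_powC -sumrB.
  apply: eq_bigr => p _; rewrite uE -scaleN1r addrC.
  by rewrite (mulPl _ (-1) (j p.1)) scaleN1r addrC.
by rewrite telescope_conv_pow conv_pow0 ?subr0 // j0.
Qed.

End Inverse.
End Convolution.

(** * Maps that descend to the quotient *)

Section CoidealIdentity.
Variables (k : comPzRingType) (X Omega : Type) (lam : Omega -> k).
Notation forest := (forest X Omega).
Variables (V : lmodType k) (t : forest -> forest -> V).

Definition RB_function (f : forest -> V) : Prop :=
  forall al be F G,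
    f [:: Node al F; Node be G] =
    f [:: Node al (F ++ [:: Node be G])] + f [:: Node be (Node al F :: G)]
    + lam be *: f [:: Node al (F ++ G)].

(** The heart of the coideal property: if t satisfies the Rota-Baxter relation in
    each of its two arguments, so does the sum of t over the cuts. The cuts of a
    product of two trees split according to which roots they keep. When a root
    goes to the subforest, the relation is used on the left or the three terms
    match directly; when both roots stay, it is used on the right. *)
Lemma RB_cuts :
  (forall F, RB_function (t F)) -> (forall G, RB_function (t^~ G)) ->
  RB_function (fun F => \sum_(p <- cuts F) t p.1 p.2).
Proof.
move=> tr tl al be F G.
have cuts2 G' (f : forest * forest -> V) :
    \sum_(p <- cuts (Node al F :: G')) f p =
    \sum_(q <- cuts G') f (Node al F :: q.1, q.2)
    + \sum_(p <- cuts F) \sum_(q <- cuts G') f (p.1 ++ q.1, Node al p.2 :: q.2).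
  by rewrite -cat1s sum_cuts_cat sum_cuts_Node.
have cuts2' (f : forest * forest -> V) :
    \sum_(p <- cuts (F ++ [:: Node be G])) f p =
    \sum_(p <- cuts F) f (p.1 ++ [:: Node be G], p.2)
    + \sum_(p <- cuts F) \sum_(q <- cuts G) f (p.1 ++ q.1, p.2 ++ [:: Node be q.2]).
  rewrite sum_cuts_cat -big_split; apply: eq_bigr => p _.
  by rewrite sum_cuts_Node /= ?cats0.
rewrite 3!sum_cuts_Node /=.
rewrite 2!cuts2 cuts2' sum_cuts_cat /= sum_cuts_Node /= tl.
under [X in _ + X = _]eq_bigr do rewrite sum_cuts_Node /= ?cats0.
rewrite [X in _ + X = _]big_split /=.
have -> : \sum_(p <- cuts F) \sum_(q <- cuts G)
      t (p.1 ++ q.1) [:: Node al p.2; Node be q.2] =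
    \sum_(p <- cuts F) \sum_(q <- cuts G)
      t (p.1 ++ q.1) [:: Node al (p.2 ++ [:: Node be q.2])]
    + \sum_(p <- cuts F) \sum_(q <- cuts G)
      t (p.1 ++ q.1) [:: Node be (Node al p.2 :: q.2)]
    + lam be *: \sum_(p <- cuts F) \sum_(q <- cuts G)
      t (p.1 ++ q.1) [:: Node al (p.2 ++ q.2)].
  rewrite scaler_sumr -2!big_split; apply: eq_bigr => p _ /=.
  by rewrite scaler_sumr -2!big_split; apply: eq_bigr => q _; exact: tr.
rewrite scalerDr.
by rewrite (AC (3*1*(1*3)) (1*(5*6)*(2*(4*7))*(3*8))).
Qed.
End CoidealIdentity.

Section Descent.
Variables (k : comPzRingType) (X Omega : Type) (lam : Omega -> k).
Notation word := (word X Omega).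
Notation forest := (forest X Omega).
Notation kM := (freeMod k word).
Notation H := (freeMod k (set_type (@Linf X Omega))).
Notation class := (@class k X Omega lam).

Lemma induced_linear (M : lmodType k) (f : forest -> M) : linear (induced f).
Proof. by move=> z a b; exact: linearP. Qed.

Lemma theta_basis_linear (M : lmodType k) (f : forest -> M) :
  linear (theta_basis f).
Proof. by move=> z a b; exact: linearP. Qed.

Lemma theta_basis_basis (M : lmodType k) (f : forest -> M) u :
  theta_basis f (basis k u) = f (theta_word u).
Proof. exact: linext_basis. Qed.

Lemma theta_basis_comp (M N : lmodType k) (f : forest -> M) (g : M -> N) a :
  linear g -> theta_basis (fun F => g (f F)) a = g (theta_basis f a).
Proof.
move=> lg; linear_ext_on a => [||u].
- exact: theta_basis_linear.
- exact: (linear_comp lg (theta_basis_linear f)).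
by rewrite 2!theta_basis_basis.
Qed.

Lemma theta_basis_add (M : lmodType k) (f g : forest -> M) z a :
  theta_basis (fun F => z *: f F + g F) a = z *: theta_basis f a + theta_basis g a.
Proof.
linear_ext_on a => [||u].
- exact: theta_basis_linear.
- exact: (linear_add (linear_scale z (theta_basis_linear f)) (theta_basis_linear g)).
by rewrite 3!theta_basis_basis.
Qed.

Lemma descends_comp (M N : lmodType k) (f : forest -> M) (g : M -> N) :
  linear g -> descends lam f -> descends lam (fun F => g (f F)).
Proof. by move=> lg df a /df fa; rewrite theta_basis_comp // fa linear_map0. Qed.

Lemma descends_add (M : lmodType k) z (f g : forest -> M) :
  descends lam f -> descends lam g -> descends lam (fun F => z *: f F + g F).
Proof. by move=> df dg a Ia; rewrite theta_basis_add df // dg // scaler0 addr0. Qed.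

Lemma psi_word_class a : psi_word lam a = theta_basis class a.
Proof.
linear_ext_on a => [||u].
- exact: psi_word_linear.
- exact: theta_basis_linear.
by rewrite theta_basis_basis classE theta_wordK.
Qed.

Lemma descends_class : descends lam class.
Proof.
move=> a Ia; rewrite -psi_word_class.
have /psi_word_eq -> : eqm lam a 0 by rewrite /eqm subr0.
exact: (linear_map0 (@psi_word_linear k X Omega lam)).
Qed.

(** The elements of the ideal that f kills form an operated ideal as soon as f is
    multiplicative and its value on a grafting depends linearly on its value below
    and on the class below. The operator B takes that class as an argument because
    in the cocycle condition the term P(a) (x) 1 is not a function of the
    coproduct of a alone. *)
Lemma descends_ideal (M : lmodType k) (f : forest -> M)
    (mulM : M -> M -> M) (B : Omega -> H -> M -> M) :
  (forall b, linear (mulM^~ b)) -> (forall a, linear (mulM a)) ->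
  (forall w z a b c d, B w (z *: a + b) (z *: c + d) = z *: B w a c + B w b d) ->
  (forall F G, f (F ++ G) = mulM (f F) (f G)) ->
  (forall w F, f [:: Node w F] = B w (class F) (f F)) ->
  RB_function lam f -> descends lam f.
Proof.
move=> mPl mPr BP fM fB fRB a.
have fcat b c :
    theta_basis f (concat b c) = mulM (theta_basis f b) (theta_basis f c).
  linear_ext_on b => [||u].
  - exact: (linear_comp (theta_basis_linear f) (concatPl c)).
  - exact: (linear_comp (mPl _) (theta_basis_linear f)).
  linear_ext_on c => [||v].
  - exact: (linear_comp (theta_basis_linear f) (concatPr _)).
  - exact: (linear_comp (mPr _) (theta_basis_linear f)).
  by rewrite concat_basis 3!theta_basis_basis -fM /theta_word map_cat.
have fbr w b : theta_basis f (bracket w b) =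
    B w (theta_basis class b) (theta_basis f b).
  linear_ext_on b => [||u].
  - exact: (linear_comp (theta_basis_linear f) (bracketP w)).
  - by rewrite (theta_basis_linear class) (theta_basis_linear f) BP.
  by rewrite bracket_basis 3!theta_basis_basis -fB.
have B0 w : B w 0 0 = 0.
  by have := BP w (-1) 0 0 0 0; rewrite 2!scaler0 2!addr0 scaleN1r addNr.
suff iI : is_operated_ideal
    [set c | Id (RB_relations lam) c /\ theta_basis f c = 0]%classic.
  move=> /(_ _ iI) []// _ [x [y [al [be ->]]]].
  split; first by apply: RB_relation_Id; exists x, y, al, be.
  have fL := theta_basis_linear f.
  rewrite 3!(linear_mapB _ _ fL) (linear_mapZ _ _ fL) 4!theta_basis_basis /=.
  rewrite 2!map_cat /= fRB.
  by rewrite -!addrA -!opprD !addrA subrr.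
have ideal := Id_ideal (@RB_relations k X Omega lam).
split.
- split; first exact: (operated_ideal0 ideal).
  exact: (linear_map0 (theta_basis_linear f)).
- move=> b c [Ib fb] [Ic fc]; split; first exact: (operated_idealD ideal).
  by rewrite -[b]scale1r (theta_basis_linear f) fb fc scaler0 addr0.
- move=> z b [Ib fb]; split; first exact: (operated_idealZ ideal).
  by rewrite (linear_mapZ _ _ (theta_basis_linear f)) fb scaler0.
- move=> b c [Ic fc]; split; first exact: (operated_idealMl ideal).
  by rewrite fcat fc (linear_map0 (mPr _)).
- move=> b c [Ib fb]; split; first exact: (operated_idealMr ideal).
  by rewrite fcat fb (linear_map0 (mPl _)).
move=> w b [Ib fb]; split; first exact: (operated_idealP ideal).
by rewrite fbr fb (descends_class Ib).
Qed.
End Descent.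

(** * The Hopf algebra of Rota-Baxter forests *)

Section HopfStructure.
Variables (k : comPzRingType) (X Omega : Type) (lam : Omega -> k).
Notation forest := (forest X Omega).
Notation H := (freeMod k (set_type (@Linf X Omega))).
Notation HH :=
  (freeMod k (set_type (@Linf X Omega) * set_type (@Linf X Omega))%type).
Notation one := (basis k (@Linf_one X Omega)).
Notation mul := (@diamond_l k X Omega lam).
Notation unit := (@unit_l k X Omega).
Notation Delta := (@Delta_l k X Omega lam).
Notation eps := (@eps_l k X Omega).
Notation Bplus := (@Bplus k X Omega).
Notation class := (@class k X Omega lam).

Let mulPl := @diamondPl k X Omega lam.
Let mulPr := @diamondPr k X Omega lam.

Lemma diamondA : associative mul.
Proof.
move=> a b c.
move: a; apply: (class_ext (lam := lam)) => [||F].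
- exact: mulPl.
- exact: (linear_comp (mulPl c) (mulPl b)).
move: b; apply: (class_ext (lam := lam)) => [||G].
- exact: (linear_comp (mulPr _) (mulPl c)).
- exact: (linear_comp (mulPl c) (mulPr _)).
move: c; apply: (class_ext (lam := lam)) => [||K].
- exact: (linear_comp (mulPr _) (mulPr _)).
- exact: mulPr.
by rewrite -4!class_cat catA.
Qed.

Lemma diamond1l : left_id one mul.
Proof.
apply: (class_ext (lam := lam)) => [||F]; [exact: mulPr|by []|].
by rewrite -(@class_nil k X Omega lam) -class_cat.
Qed.

Lemma diamond1r : right_id one mul.
Proof.
apply: (class_ext (lam := lam)) => [||F]; [exact: mulPl|by []|].
by rewrite -(@class_nil k X Omega lam) -class_cat cats0.
Qed.

Lemma unit1 : unit 1 = one. Proof. exact: scale1r. Qed.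

Lemma unit_linear : linear (unit : k^o -> H).
Proof. by move=> z a b; rewrite /unit_l scalerDl scalerA. Qed.

Lemma sha_algebra : is_algebra mul unit.
Proof.
split; rewrite ?unit1; [exact: mulPl|exact: mulPr|exact: diamondA|exact: unit_linear
  |exact: diamond1l|exact: diamond1r].
Qed.

Definition eps_forest (F : forest) : k^o := (nilp F)%:R.

Lemma descends_eps : descends lam eps_forest.
Proof.
apply: (descends_ideal (mulM := fun a b : k^o => a * b)
  (B := fun w a c => 0)) => //.
- by move=> b z x y; rewrite mulrDl -mulrA.
- by move=> a z x y; rewrite mulrDr mulrCA.
- by move=> w z a b c d; rewrite scaler0 addr0.
- by case=> [|t F] G; rewrite /eps_forest /= ?mul1r ?mul0r.
- by move=> al be F G; rewrite /eps_forest /= scaler0 !addr0.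
Qed.

Lemma epsE a : eps a = induced eps_forest a.
Proof.
apply: eq_bigr => F _; have -> // : (F == @Linf_one X Omega) = nilp (val F).
by rewrite -val_eqE /=; case: (val F).
Qed.

Lemma eps_class F : eps (class F) = (nilp F)%:R.
Proof. by rewrite epsE (induced_class _ descends_eps). Qed.

Lemma eps_linear : scalar eps.
Proof. by move=> z a b; rewrite 3!epsE; exact: (induced_linear eps_forest z a b). Qed.

(** The composite of Delta_RT and psi (x) psi, on the basis of forests. *)
Definition Delta_forest (F : forest) : HH :=
  \sum_(p <- cuts F) tens (class p.1) (class p.2).

Lemma Bplus_tens_linear w :
  linear (fun c : HH => tensmap id (Bplus w) c).
Proof. by move=> z a b; exact: linearP. Qed.

Lemma tensmap_Bplus w a b : tensmap id (Bplus w) (tens a b) = tens a (Bplus w b) :> HH.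
Proof. by apply: tensmap_tens => //; exact: Bplus_linear. Qed.

Lemma Delta_forest_cat F G :
  Delta_forest (F ++ G) = tensmul mul (Delta_forest F) (Delta_forest G).
Proof.
rewrite /Delta_forest sum_cuts_cat.
rewrite (linear_map_sum _ _ (tensmulPl _ _)); apply: eq_bigr => p _.
rewrite (linear_map_sum _ _ (tensmulPr _ _)); apply: eq_bigr => q _.
by rewrite (tensmul_tens mulPl mulPr) 2!class_cat.
Qed.

Lemma Delta_forest_Node w F : Delta_forest [:: Node w F] =
  tens (Bplus w (class F)) one + tensmap id (Bplus w) (Delta_forest F).
Proof.
rewrite /Delta_forest sum_cuts_Node class_Node class_nil.
congr (_ + _); rewrite (linear_map_sum _ _ (Bplus_tens_linear w)).
by apply: eq_bigr => p _; rewrite class_Node tensmap_Bplus.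
Qed.

Lemma descends_Delta : descends lam Delta_forest.
Proof.
apply: (descends_ideal (mulM := tensmul mul)
  (B := fun w a c => tens (Bplus w a) one + tensmap id (Bplus w) c)).
- exact: tensmulPl.
- exact: tensmulPr.
- move=> w z a b c d; rewrite (Bplus_linear w) tensPl (Bplus_tens_linear w).
  by rewrite scalerDr addrACA.
- exact: Delta_forest_cat.
- exact: Delta_forest_Node.
apply: (RB_cuts (t := fun F G => tens (class F) (class G))) => F al be G1 G2.
  by rewrite class_RB (linear3 _ _ _ _ (tensPr _)).
by rewrite class_RB (linear3 _ _ _ _ (tensPl _)).
Qed.

Lemma DeltaE a : Delta a = induced Delta_forest a.
Proof.
have incl_linear : linear (@Sha_incl k X Omega) by move=> ? ? ?; exact: linearP.
have RT_linear : linear (@Delta_RT X Omega k) by move=> ? ? ?; exact: linearP.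
have psi2_linear : linear (tensmap (psi lam) (psi lam) :
    freeMod k (forest * forest)%type -> HH).
  by move=> ? ? ?; exact: linearP.
linear_ext_on a => [||F].
- exact: (linear_comp psi2_linear (linear_comp RT_linear incl_linear)).
- exact: induced_linear.
rewrite /Delta_l [Sha_incl _]linext_basis Delta_RT_basis [RHS]linext_basis.
rewrite (linear_map_sum _ _ psi2_linear); apply: eq_bigr => p _.
by rewrite [LHS]linext_basis unlock.
Qed.

Lemma Delta_linear : linear Delta.
Proof. by move=> z a b; rewrite 3!DeltaE; exact: induced_linear. Qed.

Lemma Delta_class F : Delta (class F) = Delta_forest F.
Proof. by rewrite DeltaE (induced_class _ descends_Delta). Qed.

Lemma tensA_linear (A B C : choiceType) : linear (@tensA k A B C).
Proof. by move=> z a b; exact: linearP. Qed.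

Lemma tensmap_linear (A B C D : choiceType) (f : freeMod k A -> freeMod k C)
    (g : freeMod k B -> freeMod k D) : linear (tensmap f g).
Proof. by move=> z a b; exact: linearP. Qed.

Lemma Delta_coassoc a :
  tensA (tensmap Delta id (Delta a)) = tensmap id Delta (Delta a).
Proof.
have lin_id : linear (id : H -> H) by [].
move: a; apply: (class_ext (lam := lam)) => [||F].
- exact: (linear_comp (@tensA_linear _ _ _)
    (linear_comp (tensmap_linear Delta id) Delta_linear)).
- exact: (linear_comp (tensmap_linear id Delta) Delta_linear).
rewrite Delta_class /Delta_forest.
transitivity (\sum_(p <- cuts F) \sum_(q <- cuts p.1)
    tens (class q.1) (tens (class q.2) (class p.2))).
  rewrite (linear_map_sum _ _ (tensmap_linear _ _)).
  rewrite (linear_map_sum _ _ (@tensA_linear _ _ _)); apply: eq_bigr => p _.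
  rewrite (tensmap_tens _ _ Delta_linear lin_id) Delta_class /Delta_forest tens_suml.
  rewrite (linear_map_sum _ _ (@tensA_linear _ _ _)); apply: eq_bigr => q _.
  exact: tensA_tens.
rewrite (sum_cuts_coassoc F (fun a b c => tens (class a) (tens (class b) (class c)))).
rewrite (linear_map_sum _ _ (tensmap_linear _ _)); apply: eq_bigr => p _.
rewrite (tensmap_tens _ _ lin_id Delta_linear) Delta_class /Delta_forest.
by rewrite (linear_map_sum _ _ (tensPr _)).
Qed.

Lemma Delta_counitl a :
  linext (fun p => eps (basis k p.1) *: basis k p.2) (Delta a) = a.
Proof.
have lin (B : choiceType) (M : lmodType k) (f : B -> M) : linear (linext f).
  by move=> ? ? ?; exact: linearP.
move: a; apply: (class_ext (lam := lam)) => [||F].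
- exact: (linear_comp (lin _ _ _) Delta_linear).
- by [].
rewrite Delta_class (linear_map_sum _ _ (lin _ _ _)).
rewrite -[RHS](sum_cuts_counitl F class); apply: eq_bigr => p _.
rewrite (bilinear_tens (h := fun a b => eps a *: b)) => [|b z x y|c z x y].
- by rewrite eps_class scaler_nat.
- by rewrite eps_linear scalerDl scalerA.
by rewrite scalerDr !scalerA mulrC.
Qed.

Lemma Delta_counitr a :
  linext (fun p => eps (basis k p.2) *: basis k p.1) (Delta a) = a.
Proof.
have lin (B : choiceType) (M : lmodType k) (f : B -> M) : linear (linext f).
  by move=> ? ? ?; exact: linearP.
move: a; apply: (class_ext (lam := lam)) => [||F].
- exact: (linear_comp (lin _ _ _) Delta_linear).
- by [].
rewrite Delta_class (linear_map_sum _ _ (lin _ _ _)).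
rewrite -[RHS](sum_cuts_counitr F class); apply: eq_bigr => p _.
rewrite (bilinear_tens (h := fun a b => eps b *: a)) => [|b z x y|c z x y].
- by rewrite eps_class scaler_nat.
- by rewrite scalerDr !scalerA mulrC.
by rewrite eps_linear scalerDl scalerA.
Qed.

Lemma sha_coalgebra : is_coalgebra Delta eps.
Proof.
split; [exact: Delta_linear|exact: eps_linear|exact: Delta_coassoc
  |exact: Delta_counitl|exact: Delta_counitr].
Qed.

Lemma Delta_mul a b : Delta (mul a b) = tensmul mul (Delta a) (Delta b).
Proof.
move: a; apply: (class_ext (lam := lam)) => [||F].
- exact: (linear_comp Delta_linear (mulPl b)).
- exact: (linear_comp (tensmulPl _ _) Delta_linear).
move: b; apply: (class_ext (lam := lam)) => [||G].
- exact: (linear_comp Delta_linear (mulPr _)).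
- exact: (linear_comp (tensmulPr _ _) Delta_linear).
by rewrite -class_cat 3!Delta_class Delta_forest_cat.
Qed.

Lemma eps_mul a b : eps (mul a b) = eps a * eps b.
Proof.
move: a; apply: (class_ext (M := k^o) (lam := lam)) => [||F].
- exact: (linear_comp (eps_linear : linear (eps : H -> k^o)) (mulPl b)).
- by move=> z x y; rewrite eps_linear mulrDl -mulrA.
move: b; apply: (class_ext (M := k^o) (lam := lam)) => [||G].
- exact: (linear_comp (eps_linear : linear (eps : H -> k^o)) (mulPr _)).
- by move=> z x y; rewrite eps_linear mulrDr mulrCA.
rewrite -class_cat 3!eps_class.
by case: F => [|t F]; rewrite /= ?mul1r ?mul0r.
Qed.

Lemma sha_bialgebra : is_bialgebra mul unit Delta eps.
Proof.
split; rewrite ?unit1; [exact: sha_algebra|exact: sha_coalgebra| |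
  exact: Delta_mul| |exact: eps_mul].
- by rewrite -(@class_nil k X Omega lam) Delta_class /Delta_forest sum_cuts_nil.
by rewrite -(@class_nil k X Omega lam) eps_class.
Qed.

Lemma sha_cocycle : is_cocycle_family unit Delta Bplus.
Proof.
move=> w; split; first exact: Bplus_linear.
apply: (class_ext (lam := lam)) => [||F].
- exact: (linear_comp Delta_linear (@Bplus_linear _ _ _ w)).
- apply: linear_add; last exact: (linear_comp (Bplus_tens_linear w) Delta_linear).
  exact: (linear_comp (tensPl _) (@Bplus_linear _ _ _ w)).
by rewrite unit1 -class_Node 2!Delta_class Delta_forest_Node class_Node.
Qed.

Lemma unit_nat n : unit n%:R = one *+ n.
Proof. exact: scaler_nat. Qed.

Lemma multens_tensmap (f g : H -> H) F : linear f -> linear g ->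
  multens mul (tensmap f g (Delta_forest F)) =
  \sum_(p <- cuts F) mul (f (class p.1)) (g (class p.2)).
Proof.
move=> lf lg; rewrite (linear_map_sum _ _ (tensmap_linear f g)).
rewrite (linear_map_sum _ _ (multens_linear _)); apply: eq_bigr => p _.
by rewrite (tensmap_tens _ _ lf lg) (multens_tens mulPl mulPr).
Qed.

(** The convolution of two maps is a function of [Delta_forest], which descends. *)
Lemma descends_conv (u v : forest -> H) :
  descends lam u -> descends lam v -> descends lam (conv mul u v).
Proof.
move=> du dv.
have -> : conv mul u v =
    fun F => multens mul (tensmap (induced u) (induced v) (Delta_forest F)).
  apply/funext => F.
  rewrite multens_tensmap; [|exact: induced_linear|exact: induced_linear].
  by apply: eq_bigr => p _; rewrite (induced_class _ du) (induced_class _ dv).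
apply: (descends_comp (g := fun s => multens mul (tensmap _ _ s)) _ descends_Delta).
exact: (linear_comp (multens_linear mul) (tensmap_linear _ _)).
Qed.

Lemma descends_conv_unit : descends lam (@conv_unit k X Omega H one).
Proof.
have -> : @conv_unit k X Omega H one = fun F => unit (eps_forest F).
  by apply/funext => F; rewrite /conv_unit /eps_forest unit_nat.
exact: (descends_comp unit_linear descends_eps).
Qed.

Lemma descends_conv_pow n :
  descends lam (conv_pow mul one (fun F => conv_unit one F - class F) n).
Proof.
elim: n => [|n IHn]; first exact: descends_conv_unit.
apply: descends_conv => //.
have -> : (fun F => conv_unit one F - class F) =
    fun F => (-1) *: class F + conv_unit one F.
  by apply/funext => F; rewrite scaleN1r addrC.
by apply: descends_add; [exact: descends_class | exact: descends_conv_unit].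
Qed.

(** On a given element only finitely many forests occur, hence the series is a
    finite sum of convolution powers, each of which descends. *)
Lemma descends_conv_inv : descends lam (conv_inv mul one class).
Proof.
move=> a Ia; pose N := (\max_(u <- msupp a) weight (theta_word u)).+1.
pose pow n := conv_pow mul one (fun F => conv_unit one F - class F) n.
transitivity (\sum_(n < N) theta_basis (pow n) a).
  rewrite /theta_basis /linext exchange_big /=.
  rewrite big_seq [RHS]big_seq; apply: eq_bigr => u ua.
  rewrite -scaler_sumr; congr (_ *: _).
  apply: (conv_inv_stable mulPl mulPr); first exact: class_nil.
  by rewrite ltnS; exact: leq_bigmax_seq.
by rewrite big1 // => n _; exact: descends_conv_pow.
Qed.

Definition antipode : H -> H := induced (conv_inv mul one class).

(** The antipode is the convolution inverse of the map [class], carried to the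
    quotient. *)
Lemma antipodeP : is_antipode mul unit Delta eps antipode.
Proof.
have lS : linear antipode by exact: induced_linear.
have lin_id : linear (id : H -> H) by [].
have S_class F : antipode (class F) = conv_inv mul one class F.
  exact: induced_class descends_conv_inv.
have unit_eps F : unit (eps (class F)) = conv_unit one F.
  by rewrite eps_class unit_nat.
have lue : linear (fun a => unit (eps a)).
  exact: (linear_comp unit_linear (eps_linear : linear (eps : H -> k^o))).
split=> //.
- apply: (class_ext (lam := lam)) => [||F]; [|exact: lue|].
    exact: (linear_comp (multens_linear mul)
      (linear_comp (tensmap_linear antipode id) Delta_linear)).
  rewrite Delta_class (multens_tensmap _ lS lin_id) unit_eps.
  rewrite -(conv_invl mulPl mulPr diamond1r (@class_nil k X Omega lam)).
  by apply: eq_bigr => p _; rewrite S_class.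
apply: (class_ext (lam := lam)) => [||F]; [|exact: lue|].
  exact: (linear_comp (multens_linear mul)
    (linear_comp (tensmap_linear id antipode) Delta_linear)).
rewrite Delta_class (multens_tensmap _ lin_id lS) unit_eps.
rewrite -(conv_invr mulPl mulPr diamondA diamond1l diamond1r
  (@class_nil k X Omega lam)).
by apply: eq_bigr => p _; rewrite S_class.
Qed.

End HopfStructure.

Theorem theorem4p7 (k : comPzRingType) (X Omega : Type)
    (Omega_nonempty : inhabited Omega) (lam : Omega -> k) :
  is_cocycle_hopf_algebra
    (@diamond_l k X Omega lam) (@unit_l k X Omega)
    (@Delta_l k X Omega lam) (@eps_l k X Omega) (@Bplus k X Omega).
Proof.
have bialg := @sha_bialgebra k X Omega lam.
split; first by split=> //; exact: sha_cocycle.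
by split=> //; exists (@antipode k X Omega lam); exact: antipodeP.
Qed.
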